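(* Let $\mathbb{D}=\{\xi\in\mathbb{C}:|\xi|<1\}$, let $K\subset\mathbb{D}$ be a nonempty removable set, and let $\Omega=\mathbb{D}\setminus K$ be a domain in $\mathbb{C}$. Then $$H_{\Omega}^{c}(z)=i_{\Omega}^{c}(z)=\min_{w\in K}\left|\frac{w-z}{1-\overline{z}w}\right|\qquad\text{for all } z\in\Omega .$$
   Context: A compact set $K\subset\mathbb{C}$ is called removable (for bounded holomorphic functions) if for every open set $U\supseteq K$ in $\mathbb{C}$, each bounded holomorphic function on $U\setminus K$ extends holomorphically to all of $U$. A removable set in a domain $G$ is a removable compact set contained in $G$. The Carathéodory pseudodistance on a domain $G\subseteq\mathbb{C}$ is $$c_G(\xi_1,\xi_2)=\sup\{\tanh^{-1}|\alpha| : f:G\to\mathbb{D}\text{ holomorphic},\ f(\xi_1)=0,\ f(\xi_2)=\alpha\}.$$ $G$ is $c$-hyperbolic if $c_G$ is a distance. For $z\in G$ and $r>0$ put $B_G^c(z,r)=\{\xi\in G: c_G(z,\xi)<r\}$. For a $c$-hyperbolic domain $G\subseteq\mathbb{C}$ and $z\in G$: the (modified) Fridman invariant with respect to the Carathéodory metric is $$H_G^c(z)=\sup\{\tanh r : r>0,\ B_G^c(z,r)\subseteq f(\mathbb{D})\text{ for some injective holomorphic } f:\mathbb{D}\to G\};$$ the injectivity radius function with respect to the Carathéodory metric is $$i_G^c(z)=\sup\{\tanh r : r>0,\ B_G^c(z,r)\text{ is simply connected}\}$$ (simply connected includes connected). *)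

(* Defs.v *)
From HB Require Import structures.
From mathcomp Require Import all_boot all_order all_algebra.
From mathcomp Require Import complex.
From mathcomp Require Import all_classical all_reals all_analysis.

Set Implicit Arguments.
Unset Strict Implicit.
Unset Printing Implicit Defensive.

Import Order.TTheory GRing.Theory Num.Theory.
Import numFieldNormedType.Exports.
Import Normc.

Local Open Scope classical_set_scope.
Local Open Scope complex_scope.
Local Open Scope ring_scope.

(* The usual topology of the complex plane: R[i] as a normed space over itself,
   for the modulus. *)
HB.instance Definition _ (R : realType) := NormedModule.copy R[i] R[i]^o.

Section CaratheodoryInvariants.
Variable R : realType.
Implicit Types (G U K : set R[i]) (f g : R[i] -> R[i]) (z w xi : R[i]).

Definition unit_disc : set R[i] := [set z | normc z < 1].

Definition domain G := [/\ open G, connected G & G !=set0].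

(* The increment of [derivable] ranges over the scalar field R[i], so this is
   complex differentiability; f is total and its values outside U are
   irrelevant when U is open. *)
Definition holomorphic_on U f := forall z, U z -> derivable f z 1.

Definition removable K :=
  compact K /\
  forall U, open U -> K `<=` U ->
  forall f, holomorphic_on (U `\` K) f -> [bounded f z | z in U `\` K] ->
  exists2 g, holomorphic_on U g & forall z, (U `\` K) z -> g z = f z.

Definition removable_in G K := removable K /\ K `<=` G.

Definition artanh (x : R) : R := ln ((1 + x) / (1 - x)) / 2.

Definition tanh (x : R) : R := (expR x - expR (- x)) / (expR x + expR (- x)).

Definition caratheodory G xi1 xi2 : \bar R :=
  ereal_sup [set (artanh (normc (f xi2)))%:E | f in
    [set f | [/\ holomorphic_on G f, f @` G `<=` unit_disc & f xi1 = 0]]].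

Definition caratheodory_ball G z (r : R) : set R[i] :=
  [set xi | G xi /\ (caratheodory G z xi < r%:E)%E].

Definition unit_interval : set R := `[0, 1].

Definition path_connected_set (A : set R[i]) :=
  A !=set0 /\
  forall x y, A x -> A y -> exists gamma : R -> R[i],
    [/\ {within unit_interval, continuous gamma},
        gamma @` unit_interval `<=` A, gamma 0 = x & gamma 1 = y].

(* H (s, t) is a homotopy with parameter s, relative to the base point, from
   the loop gamma (s = 0) to the constant loop (s = 1). *)
Definition null_homotopic_in (A : set R[i]) (gamma : R -> R[i]) :=
  exists H : R * R -> R[i],
    [/\ {within unit_interval `*` unit_interval, continuous H},
        H @` (unit_interval `*` unit_interval) `<=` A,
        forall t, unit_interval t ->
          H (0, t) = gamma t /\ H (1, t) = gamma 0 &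
        forall s, unit_interval s ->
          H (s, 0) = gamma 0 /\ H (s, 1) = gamma 0].

Definition simply_connected (A : set R[i]) :=
  path_connected_set A /\
  forall gamma : R -> R[i],
    {within unit_interval, continuous gamma} ->
    gamma @` unit_interval `<=` A -> gamma 0 = gamma 1 ->
    null_homotopic_in A gamma.

(* The two real suprema below are over sets of values of tanh on positive
   reals, hence bounded by 1. *)
Definition fridman G z : R :=
  sup [set tanh r | r in
    [set r | 0 < r /\ exists f,
      [/\ holomorphic_on unit_disc f, {in unit_disc &, injective f},
          f @` unit_disc `<=` G &
          caratheodory_ball G z r `<=` f @` unit_disc]]].

Definition injectivity_radius G z : R :=
  sup [set tanh r | r in
    [set r | 0 < r /\ simply_connected (caratheodory_ball G z r)]].

Definition is_minimum (S : set R) (m : R) := S m /\ lbound S m.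

End CaratheodoryInvariants.

Arguments unit_disc {R}.

(* Main.v *)
(* Write rho(w) = |(w - z)/(1 - conj(z) w)|. Bounded holomorphic functions on
   D \ K extend to D, so by the Schwarz-Pick lemma the Caratheodory distance of
   D \ K from z is artanh rho, and its balls are the pseudo-hyperbolic discs
   minus K. As long as such a disc misses K it is a Moebius image of a Euclidean
   disc, hence simply connected and the image of an injective map of D.

   Once the disc contains a point w of K, either property of the ball would
   provide a continuous square root of xi - w on (disc) \ K: by monodromy if the
   ball is simply connected, and by transport of a square root of f - w from D
   if the ball lies in f(D). No such root exists. Indeed removability makes K
   totally disconnected: if a <> b in K are joined by chains in K of arbitrarily
   small mesh, then products of principal roots of (xi - a_i)/(xi - a_(i+1))
   define a square root of (xi - a)/(xi - b) on D \ K, so that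
   (xi - a)(xi - b) has a holomorphic square root on D, although it has a simple
   zero at a. Hence w lies in a small relatively clopen part of K; extended by 0
   near the rest of K, the root of xi - w extends across K, and xi - w would be a
   square near w.

   The maximum principle rests on Goursat's bisection argument, applied to
   F(p + r exp(zeta)) on a rectangle of height 2 pi; antiderivatives of the
   restrictions to the sides take the place of path integrals. *)
Require Import Defs.
From mathcomp Require Import all_boot all_order all_algebra.
From mathcomp Require Import complex.
From mathcomp Require Import all_classical all_reals all_analysis.
From mathcomp Require Import ring lra.

Set Implicit Arguments.
Unset Strict Implicit.
Unset Printing Implicit Defensive.

Import Order.TTheory GRing.Theory Num.Theory.
Import numFieldNormedType.Exports.
Import Normc.
Local Open Scope classical_set_scope.
Local Open Scope complex_scope.
Local Open Scope ring_scope.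
Local Notation Re := complex.Re.
Local Notation Im := complex.Im.

(** * Modulus, neighbourhoods and limits in the complex plane *)

Section ComplexPlane.
Variable R : realType.
Local Notation C := R[i].
Implicit Types (z w : C) (x y e : R).

(** Square roots take the place of logarithms and winding numbers: a root of a bounded function is
    bounded, so removability extends it, and the contradiction then rests only on the fact that a
    square has no simple zero. Identities between holomorphic functions are carried across K by the
    maximum principle with bound 0. As K is compact in D, it misses an annulus at the unit circle,
    and a bound on that annulus controls the function on all of D, K included. Chains stand in for
    connected components because the class of w under chains of mesh d has distance at least d from
    the rest of K; this is the separation that extension by 0 requires. Only first-order
    differentiability is ever handled. The Schwarz lemma is obtained from powers of the slope at 0,
    and the inverse of an injective map f is continuous by the maximum principle for the reciprocal
    of f - f(zeta). *)

Lemma normc_ge0 z : 0 <= normc z.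
Proof. by case: z => a b; rewrite /normc sqrtr_ge0. Qed.

Lemma normr_normc z : `|z| = (normc z)%:C.
Proof. by case: z. Qed.

Lemma normc_eq0 z : (normc z == 0) = (z == 0).
Proof. by apply/eqP/eqP => [/eq0_normc//|->]; rewrite normc0. Qed.

Lemma normc_gt0 z : (0 < normc z) = (z != 0).
Proof. by rewrite lt_def normc_eq0 normc_ge0 andbT. Qed.

Lemma ler_normcD z w : normc (z + w) <= normc z + normc w.
Proof. exact: le_normcD. Qed.

Lemma normcN z : normc (- z) = normc z.
Proof. exact: (@normcN R z). Qed.

Lemma normcB z w : normc (z - w) = normc (w - z).
Proof. by rewrite -normcN opprB. Qed.

Lemma ler_normcB z w : normc (z - w) <= normc z + normc w.
Proof. by rewrite -(normcN w) ler_normcD. Qed.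

Lemma lerB_normc z w : normc z - normc w <= normc (z - w).
Proof. by rewrite lerBlDr -{1}(subrK w z) ler_normcD. Qed.

Lemma normcX z n : normc (z ^+ n) = normc z ^+ n.
Proof. by elim: n => [|n IH]; rewrite ?expr0 ?normc1// !exprS normcM IH. Qed.

Lemma normcR x : normc x%:C = `|x|.
Proof. by rewrite /normc /= expr0n addr0 sqrtr_sqr. Qed.

Lemma sqr_normc_ReIm z : normc z ^+ 2 = Re z ^+ 2 + Im z ^+ 2.
Proof. by case: z => a b; rewrite /normc sqr_sqrtr// addr_ge0// sqr_ge0. Qed.

Lemma normcJ z : normc z^* = normc z.
Proof. by case: z => a b; rewrite /normc /= sqrrN. Qed.

Lemma ler_Re_normc z : `|Re z| <= normc z.
Proof.
rewrite -(ler_pXn2r (n := 2)) ?nnegrE ?normc_ge0// sqr_normc_ReIm.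
by rewrite real_normK ?num_real// lerDl sqr_ge0.
Qed.

Lemma ler_Im_normc z : `|Im z| <= normc z.
Proof.
rewrite -(ler_pXn2r (n := 2)) ?nnegrE ?normc_ge0// sqr_normc_ReIm.
by rewrite real_normK ?num_real// lerDr sqr_ge0.
Qed.

Lemma normc_le_ReIm z : normc z <= `|Re z| + `|Im z|.
Proof.
rewrite -(ler_pXn2r (n := 2)) ?nnegrE ?normc_ge0 ?addr_ge0// sqr_normc_ReIm.
rewrite sqrrD !real_normK ?num_real// lerD2r lerDl.
by rewrite mulrn_wge0// mulr_ge0.
Qed.

Lemma eqC_ReIm z w : Re z = Re w -> Im z = Im w -> z = w.
Proof. by case: z; case: w => ? ? ? ? /= -> ->. Qed.

Lemma ReD z w : Re (z + w) = Re z + Re w. Proof. by case: z; case: w. Qed.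
Lemma ImD z w : Im (z + w) = Im z + Im w. Proof. by case: z; case: w. Qed.
Lemma ReN z : Re (- z) = - Re z. Proof. by case: z. Qed.
Lemma ImN z : Im (- z) = - Im z. Proof. by case: z. Qed.
Lemma ReB z w : Re (z - w) = Re z - Re w. Proof. by rewrite ReD ReN. Qed.
Lemma ImB z w : Im (z - w) = Im z - Im w. Proof. by rewrite ImD ImN. Qed.
Lemma ReM z w : Re (z * w) = Re z * Re w - Im z * Im w.
Proof. by case: z; case: w. Qed.
Lemma ImM z w : Im (z * w) = Re z * Im w + Im z * Re w.
Proof. by case: z; case: w. Qed.

Lemma nbhsCP z (A : set C) :
  nbhs z A <-> exists2 e, 0 < e & forall w, normc (w - z) < e -> A w.
Proof.
split=> [/nbhs_ballP[e /= e0 eA]|[e e0 eA]].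
  (* The radius of a ball is an element of [R[i]]; being positive for the order of [R[i]], it has
     zero imaginary part and may be replaced by its real part. *)
  move: e0; rewrite ltcE /= => /andP[/eqP e1 e0].
  exists (Re e) => // w we; apply: eA; rewrite /ball /= normr_normc.
  by rewrite ltcE /= e1 eqxx normcB.
apply/nbhs_ballP; exists e%:C; first by rewrite /= ltcR.
by move=> w; rewrite /ball /= normr_normc ltcR normcB => /eA.
Qed.

Lemma nbhsC_disc z e : 0 < e -> \forall w \near z, normc (w - z) < e.
Proof. by move=> e0; apply/nbhsCP; exists e. Qed.

Lemma openCP (A : set C) : open A <->
  forall z, A z -> exists2 e, 0 < e & forall w, normc (w - z) < e -> A w.
Proof.
rewrite openE; split=> [oA z /oA /nbhsCP//|oA z Az].
by apply/nbhsCP; apply: oA.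
Qed.

Lemma cvgCP T (F : set_system T) {FF : Filter F} (f : T -> C) (l : C) :
  f t @[t --> F] --> l <->
  forall e, 0 < e -> \forall t \near F, normc (f t - l) < e.
Proof.
split=> [fl e e0|fl].
  by apply: (fl [set w | normc (w - l) < e]); exact: nbhsC_disc.
by move=> A /nbhsCP[e e0 eA]; apply: filterS (fl e e0) => t /eA.
Qed.

Lemma cvgC_atP (f : C -> C) z (l : C) : f w @[w --> z] --> l <->
  forall e, 0 < e -> exists2 d, 0 < d &
    forall w, normc (w - z) < d -> normc (f w - l) < e.
Proof.
split=> [/(@cvgCP _ (nbhs z)) fl e /fl /nbhsCP//|fl].
by apply/(@cvgCP _ (nbhs z)) => e /fl dP; apply/nbhsCP.
Qed.

Lemma cvgRP T (F : set_system T) {FF : Filter F} (f : T -> R) (l : R) :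
  f t @[t --> F] --> l <->
  forall e, 0 < e -> \forall t \near F, `|f t - l| < e.
Proof. exact: cvgrPdistC_lt. Qed.

Section Limits.
Context T (F : set_system T) {FF : Filter F}.
Implicit Types (f g : T -> C) (a b : C).

Lemma cvgC_add f g a b : f t @[t --> F] --> a -> g t @[t --> F] --> b ->
  (f t + g t) @[t --> F] --> a + b.
Proof. exact: (@cvgD C C T F FF f g a b). Qed.

Lemma cvgC_opp f a : f t @[t --> F] --> a -> (- f t) @[t --> F] --> - a.
Proof. exact: (@cvgN C C T F FF f a). Qed.

Lemma cvgC_sub f g a b : f t @[t --> F] --> a -> g t @[t --> F] --> b ->
  (f t - g t) @[t --> F] --> a - b.
Proof. by move=> fa gb; exact: (cvgC_add fa (cvgC_opp gb)). Qed.

Lemma cvgC_mul f g a b : f t @[t --> F] --> a -> g t @[t --> F] --> b ->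
  (f t * g t) @[t --> F] --> a * b.
Proof. exact: (@cvgM C T F FF f g a b). Qed.

Lemma cvgC_inv f a : a != 0 -> f t @[t --> F] --> a ->
  (f t)^-1 @[t --> F] --> a^-1.
Proof. exact: (@cvgV C T F FF f a). Qed.

Lemma cvgC_cst a : a @[t --> F] --> a.
Proof. by apply/cvgCP => e e0; apply: nearW => t; rewrite subrr normc0. Qed.

Lemma cvgC_comp f (g : C -> C) a : f t @[t --> F] --> a ->
  g w @[w --> a] --> g a -> g (f t) @[t --> F] --> g a.
Proof. by move=> fa ga A /ga /fa. Qed.

Lemma cvgC_exp f a n : f t @[t --> F] --> a ->
  (f t ^+ n) @[t --> F] --> a ^+ n.
Proof.
move=> fa; elim: n => [|n IH]; first exact: cvgC_cst.
under eq_fun do rewrite exprS.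
by rewrite exprS; exact: (cvgC_mul fa IH).
Qed.

Lemma cvg_Re f a : f t @[t --> F] --> a -> Re (f t) @[t --> F] --> Re a.
Proof.
move=> /cvgCP fa; apply/cvgRP => e /fa; apply: filterS => t.
by apply: le_lt_trans; rewrite -ReB ler_Re_normc.
Qed.

Lemma cvg_Im f a : f t @[t --> F] --> a -> Im (f t) @[t --> F] --> Im a.
Proof.
move=> /cvgCP fa; apply/cvgRP => e /fa; apply: filterS => t.
by apply: le_lt_trans; rewrite -ImB ler_Im_normc.
Qed.

Lemma cvg_Complex (f g : T -> R) (a b : R) :
  f t @[t --> F] --> a -> g t @[t --> F] --> b ->
  (f t +i* g t) @[t --> F] --> (a +i* b : C).
Proof.
move=> /cvgRP fa /cvgRP gb; apply/cvgCP => e e0.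
have e2 : 0 < e / 2 by rewrite divr_gt0.
apply: filterS2 (fa _ e2) (gb _ e2) => t fe ge.
rewrite (le_lt_trans (normc_le_ReIm _))//= (splitr e) ltrD//.
Qed.

Lemma cvg_realC (f : T -> R) a : f t @[t --> F] --> Re a -> Im a = 0 ->
  (f t)%:C @[t --> F] --> a.
Proof.
case: a => a b /= fa ->.
have c0 : (fun=> 0 : R) @ F --> (0 : R) by exact: cvg_cst.
exact: (cvg_Complex fa c0).
Qed.

Lemma cvg_normc f a : f t @[t --> F] --> a ->
  normc (f t) @[t --> F] --> normc a.
Proof.
move=> /cvgCP fa; apply/cvgRP => e /fa; apply: filterS => t.
apply: le_lt_trans; rewrite ler_norml lerB_normc andbT lerNl opprB normcB.
exact: lerB_normc.
Qed.

Lemma cvgR_add (f g : T -> R) (a b : R) : f t @[t --> F] --> a ->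
  g t @[t --> F] --> b -> (f t + g t) @[t --> F] --> a + b.
Proof. exact: (@cvgD R R T F FF f g a b). Qed.

Lemma cvgR_mul (f g : T -> R) (a b : R) : f t @[t --> F] --> a ->
  g t @[t --> F] --> b -> (f t * g t) @[t --> F] --> a * b.
Proof. exact: (@cvgM R T F FF f g a b). Qed.

Lemma cvgR_cst (a : R) : (fun _ : T => a) t @[t --> F] --> a.
Proof. by apply/cvgRP => e e0; apply: nearW => t; rewrite subrr normr0. Qed.

Lemma cvgR_comp (f : T -> R) (g : R -> R) (a : R) : f t @[t --> F] --> a ->
  g s @[s --> a] --> g a -> g (f t) @[t --> F] --> g a.
Proof. by move=> fa ga A /ga /fa. Qed.

End Limits.

End ComplexPlane.
Arguments cvgC_cst {R T F FF} a.
Arguments cvgC_exp {R T F FF f a} n _.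
Arguments cvgR_cst {R T F FF} a.

(** * Complex differentiability through continuous slopes *)

Section ComplexDerivative.
Variable R : realType.
Local Notation C := R[i].
Implicit Types (f g s : C -> C) (z w c : C) (x y e : R).

(* Caratheodory's formulation of complex differentiability: the slope extends
   continuously to the base point. *)
Definition cder f z := exists2 phi : C -> C,
  phi w @[w --> z] --> phi z & forall w, f w = f z + (w - z) * phi w.

Lemma cvgC_id z : w @[w --> z] --> z.
Proof. exact: cvg_id. Qed.
Arguments cvgC_id z : clear implicits.

Lemma near_at (P : C -> Prop) z : (\forall w \near z, P w) -> P z.
Proof. exact: nbhs_singleton. Qed.

Lemma cvgC_near T (F : set_system T) {FF : Filter F} (f g : T -> C) (a : C) :
  (\forall t \near F, f t = g t) -> f t @[t --> F] --> a ->
  g t @[t --> F] --> a.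
Proof.
move=> fg /cvgCP fa; apply/cvgCP => e /fa; apply: filterS2 fg => t ->//.
Qed.

Lemma cder_continuous f z : cder f z -> f w @[w --> z] --> f z.
Proof.
move=> [phi phic fE].
pose proof (cvgC_add (cvgC_cst (f z))
  (cvgC_mul (cvgC_sub (cvgC_id z) (cvgC_cst z)) phic)) as h.
rewrite subrr mul0r addr0 in h; apply: (cvgC_near _ h).
by apply: nearW => w; rewrite [RHS]fE.
Qed.

Lemma cder_near f g z : (\forall w \near z, f w = g w) -> cder f z -> cder g z.
Proof.
move=> fg [phi phic fE].
exists (fun w => if w == z then phi z else (g w - g z) / (w - z)); last first.
  move=> w; case: eqVneq => [->|wz]; first by rewrite subrr mul0r addr0.
  by rewrite mulrC divfK ?subr_eq0// addrC subrK.
rewrite eqxx; apply: (cvgC_near _ phic).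
have fgz := near_at fg.
apply: filterS fg => w fgw; case: eqVneq => [->//|wz].
rewrite -fgw -fgz fE addrAC subrr add0r mulrAC mulfV ?mul1r//.
by rewrite subr_eq0.
Qed.

Lemma eq_cder f g z : f =1 g -> cder f z -> cder g z.
Proof. by move=> /funext ->. Qed.

Lemma cder_epsP f z : cder f z <-> exists c, forall e, 0 < e ->
  exists2 d, 0 < d & forall w, normc (w - z) < d ->
    normc (f w - f z - c * (w - z)) <= e * normc (w - z).
Proof.
split=> [[phi phic fE]|[c cP]].
  exists (phi z) => e e0.
  move/cvgC_atP: phic => /(_ _ e0)[d d0 dP]; exists d => // w /dP {}dP.
  rewrite (fE w) [f z + _]addrC addrK mulrC -mulrBl normcM ler_wpM2r ?normc_ge0//.
  exact: ltW.
exists (fun w => if w == z then c else (f w - f z) / (w - z)); last first.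
  move=> w; case: eqVneq => [->|wz]; first by rewrite subrr mul0r addr0.
  by rewrite mulrC divfK ?subr_eq0// addrC subrK.
rewrite eqxx; apply/cvgC_atP => e e0.
have [|d d0 dP] := cP (e / 2); first by rewrite divr_gt0.
exists d => // w /dP; case: eqVneq => [->|wz H].
  by rewrite !subrr normc0.
have wz0 : w - z != 0 by rewrite subr_eq0.
have -> : (f w - f z) / (w - z) - c = (f w - f z - c * (w - z)) / (w - z).
  by rewrite [RHS]mulrBl mulfK.
rewrite normcM normcV ltr_pdivrMr ?normc_gt0// (le_lt_trans H)//.
rewrite ltr_pM2r ?normc_gt0// [ltRHS]splitr ltrDl divr_gt0//.
Qed.

Lemma derivable_cder f z : derivable f z 1 <-> cder f z.
Proof.
split=> [|[phi phic fE]].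
  move=> /cvg_ex[/= l]; rewrite /dnbhs => /cvgCP fl.
  apply/cder_epsP; exists l => e e0.
  have := fl e e0; rewrite near_withinE => /nbhsCP[d d0 dP].
  exists d => // w wd; have [->|wz] := eqVneq w z.
    by rewrite !subrr mulr0 subrr normc0 mulr0.
  have wz0 : w - z != 0 by rewrite subr_eq0.
  have := dP (w - z); rewrite subr0 => /(_ wd wz0).
  rewrite /= [_ *: 1](_ : _ = w - z) ?subrK; last exact: mulr1.
  rewrite [_ *: _](_ : _ = (w - z)^-1 * (f w - f z)) // => H.
  rewrite (_ : _ - _ = (w - z) * ((w - z)^-1 * (f w - f z) - l)).
    by rewrite normcM mulrC ler_wpM2r ?normc_ge0 ?ltW.
  by rewrite [RHS]mulrBr mulVKf// [l * _]mulrC.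
apply/cvg_ex; exists (phi z); apply/cvgCP => e e0.
move/cvgC_atP: phic => /(_ _ e0)[d d0 dP].
rewrite /dnbhs near_withinE; apply/nbhsCP; exists d => // h.
rewrite subr0 => hd h0; rewrite [h *: 1](_ : _ = h); last exact: mulr1.
rewrite /= (fE (h + z)) addrAC subrr add0r addrK.
rewrite [h^-1 *: _](_ : _ = h^-1 * (h * phi (h + z))) // mulKf //.
by apply: dP; rewrite addrK.
Qed.

Lemma cder_cst c z : cder (fun=> c) z.
Proof.
exists (fun=> 0) => [|w]; first exact: (@cvgC_cst _ _ (nbhs z)).
by rewrite mulr0 addr0.
Qed.

Lemma cder_id z : cder id z.
Proof.
exists (fun=> 1) => [|w]; first exact: (@cvgC_cst _ _ (nbhs z)).
by rewrite mulr1 addrC subrK.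
Qed.

Lemma cder_add f g z : cder f z -> cder g z -> cder (fun w => f w + g w) z.
Proof.
move=> [p pc pE] [q qc qE]; exists (fun w => p w + q w).
  exact: (cvgC_add pc qc).
by move=> w; rewrite (pE w) (qE w); ring.
Qed.

Lemma cder_mul f g z : cder f z -> cder g z -> cder (fun w => f w * g w) z.
Proof.
move=> df dg; have gc := cder_continuous dg.
have [p pc pE] := df; have [q qc qE] := dg.
exists (fun w => p w * g w + f z * q w).
  exact: (cvgC_add (cvgC_mul pc gc) (cvgC_mul (cvgC_cst _) qc)).
by move=> w; rewrite (pE w) (qE w); ring.
Qed.

Lemma cder_sub f g z : cder f z -> cder g z -> cder (fun w => f w - g w) z.
Proof.
move=> df dg; have := cder_add df (cder_mul (cder_cst (-1) z) dg).
by apply: eq_cder => w; rewrite mulN1r.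
Qed.

Lemma cder_exp f z n : cder f z -> cder (fun w => f w ^+ n) z.
Proof.
move=> df; elim: n => [|n IH]; first exact: cder_cst.
have := cder_mul df IH.
by apply: eq_cder => w; rewrite exprS.
Qed.

Lemma cder_comp f g z : cder g z -> cder f (g z) -> cder (fun w => f (g w)) z.
Proof.
move=> dg [p pc pE]; have gc := cder_continuous dg.
have [q qc qE] := dg.
exists (fun w => q w * p (g w)).
  exact: (cvgC_mul qc (cvgC_comp gc pc)).
by move=> w; rewrite (pE (g w)) {1}(qE w); ring.
Qed.

Lemma near_neq0 f z : f w @[w --> z] --> f z -> f z != 0 ->
  \forall w \near z, f w != 0.
Proof.
move=> /cvgCP fc f0; have n0 : 0 < normc (f z) by rewrite normc_gt0.
apply: filterS (fc _ n0) => w; apply: contraTneq => ->.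
by rewrite sub0r normcN ltxx.
Qed.

Lemma cder_inv f z : cder f z -> f z != 0 -> cder (fun w => (f w)^-1) z.
Proof.
move=> df f0; apply: (@cder_comp (fun w => w^-1) f) => //.
(* [cder] asks for the factorisation at every point, so the inverse is altered at 0, away from
   [f z]; the value there is the one forced by the slope chosen at 0. *)
pose g w := if w == 0 then (f z)^-1 + (w - f z) * (- (f z)^-1 ^+ 2) else w^-1.
apply: (@cder_near g).
  by apply: filterS (@near_neq0 id (f z) (cvgC_id _) f0) => w; rewrite /g => /negPf ->.
exists (fun w => if w == 0 then - (f z)^-1 ^+ 2 else - (w^-1 * (f z)^-1)).
  rewrite (negPf f0) -expr2.
  apply: (@cvgC_near _ (nbhs (f z)) _ (fun w => - (w^-1 * (f z)^-1))).
    by apply: filterS (@near_neq0 id (f z) (cvgC_id _) f0) => w /negPf ->.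
  rewrite expr2.
  exact: (cvgC_opp (cvgC_mul (cvgC_inv f0 (cvgC_id _)) (cvgC_cst _))).
move=> w; rewrite /g (negPf f0); case: eqP => // /eqP w0.
by field; apply/andP.
Qed.

Lemma cder_div f g z : cder f z -> cder g z -> g z != 0 ->
  cder (fun w => f w / g w) z.
Proof. by move=> df dg g0; exact: (cder_mul df (cder_inv dg g0)). Qed.

(** The slope of [s] is the slope of [f] divided by [s w + s z], which tends to [2 * s z], a
    non-zero number. Chains and monodromy produce roots that are merely continuous; this makes them
    holomorphic. *)
Lemma cder_sqrt s f z : s w @[w --> z] --> s z -> s z != 0 ->
  (\forall w \near z, s w ^+ 2 = f w) -> cder f z -> cder s z.
Proof.
move=> sc s0 sf [p pc pE].
have scs : (s w + s z) @[w --> z] --> s z + s z.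
  exact: (cvgC_add sc (cvgC_cst _)).
have s20 : s z + s z != 0 by rewrite -mulr2n -mulr_natr mulf_neq0// pnatr_eq0.
pose h w := s z + (w - z) * (p w / (s w + s z)).
apply: (@cder_near h).
  have := near_neq0 scs s20.
  have sfz := near_at sf.
  apply: filterS2 sf => w sfw sw0; rewrite /h.
  have -> : (w - z) * (p w / (s w + s z)) = (f w - f z) / (s w + s z).
    by rewrite mulrA (pE w) addrAC subrr add0r.
  rewrite -sfw -sfz subr_sqr mulfK// addrC subrK//.
exists (fun w => p w / (s w + s z)).
  exact: (cvgC_mul pc (cvgC_inv s20 scs)).
by move=> w; rewrite {2}/h subrr mul0r addr0.
Qed.

(** Since [f] vanishes at [z], it is [(w - z) * p w], so [k w = (w - z) * p w ^+ 2] off [z], and the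
    right side tends to 0. Every contradiction with a simple zero ends here. *)
Lemma sqr_simple_zero f (k : C -> C) z : cder f z ->
  k w @[w --> z] --> k z ->
  (\forall w \near z, f w ^+ 2 = (w - z) * k w) -> k z = 0.
Proof.
move=> [p pc pE] kc fE.
have fz0 : f z = 0 by apply/eqP; rewrite -sqrf_eq0 (near_at fE) subrr mul0r.
have hc : ((w - z) * p w ^+ 2 - k w) @[w --> z] --> (z - z) * p z ^+ 2 - k z.
  exact: (cvgC_sub
    (cvgC_mul (cvgC_sub (cvgC_id z) (cvgC_cst z)) (cvgC_exp 2 pc)) kc).
apply/eqP; apply: contraT => kz0.
have hz : (z - z) * p z ^+ 2 - k z != 0 by rewrite subrr mul0r sub0r oppr_eq0.
pose proof (near_neq0 hc hz) as hn.
pose proof (filterI fE hn) as H; move/nbhsCP: H => [d d0 dP].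
have d2 : normc ((d / 2)%:C : C) < d.
  by rewrite normcR gtr0_norm ?divr_gt0// [ltRHS]splitr ltrDl divr_gt0.
have [] := dP (z + (d / 2)%:C); first by rewrite addrAC subrr add0r.
set h := (d / 2)%:C.
have h0 : h != 0 by rewrite -normc_gt0 normcR normr_gt0 mulf_neq0 ?gt_eqF ?invr_gt0.
rewrite (pE (z + h)) fz0 add0r addrAC !subrr add0r.
set q := p _ => qE; rewrite (_ : h * q ^+ 2 = k (z + h)) ?subrr ?eqxx//.
by apply: (mulfI h0); rewrite -qE; ring.
Qed.

End ComplexDerivative.
Arguments cvgC_id {R} z.

(** * Goursat's theorem on a rectangle *)

Section Goursat.
Variable R : realType.
Local Notation C := R[i].

(** The integral starts at [a], and the fundamental theorem applies at interior points of
    [[a, x + 1]]. Hence the strict inequality; uses on a closed interval start further to the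
    left. *)
Lemma antiderivative_gt (h : R -> R) (a : R) : continuous h ->
  exists U : R -> R, forall x, a < x -> is_derive x 1 U (h x).
Proof.
move=> hc; pose U x := \int[lebesgue_measure]_(t in [set` `[a, x]]) h t.
exists U => x ax.
have [||||dU eU] := @continuous_FTC1 R h (BLeft a) x (x + 1).
- by rewrite ltrDl.
- apply: continuous_compact_integrable; first exact: segment_compact.
  exact: continuous_subspaceT.
- by rewrite lte_fin.

- exact: hc.
- by apply: (DeriveDef dU); rewrite -derive1E.
Qed.

Lemma derive_bound (W w : R -> R) (a b M : R) : a <= b ->
  (forall t, a <= t <= b -> is_derive t 1 W (w t) /\ `|w t| <= M) ->
  `|W b - W a| <= M * (b - a).
Proof.
move=> ab H.
have [||c cab ->] := @MVT_segment R W w a b ab.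
- by move=> x /andP[/ltW ax /ltW xb]; apply: (H x _).1; rewrite ax.
- apply: derivable_within_continuous => x xab.
  by have [? _] := H x xab.
rewrite normrM (ger0_norm (x := b - a)) ?subr_ge0//.
by rewrite ler_wpM2r ?subr_ge0//; exact: (H c cab).2.
Qed.

Lemma is_derive_quadratic (A B t0 t : R) :
  is_derive t 1 (fun t => A * t + B * (t - t0) ^+ 2) (A + B * 2 * (t - t0)).
Proof.
have d1 : is_derive t 1 (fun s : R => s - t0) 1.
  have := is_deriveB (is_derive_id t 1) (is_derive_cst t0 t 1).
  by move/is_derive_eq; apply; rewrite subr0.
have d2 := is_deriveM d1 d1.
have d3 := is_deriveD (is_deriveZ A (is_derive_id t 1)) (is_deriveZ B d2).
have <- : A *: 1 + B *: ((t - t0) *: 1 + (t - t0) *: 1) =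
    A + B * 2 * (t - t0) by rewrite /GRing.scale /=; ring.
exact: d3.
Qed.

Lemma nested_intervals (u l : nat -> R) :
  (forall n, 0 <= l n) -> (forall n, u n <= u n.+1) ->
  (forall n, u n.+1 + l n.+1 <= u n + l n) ->
  exists p, forall n, u n <= p <= u n + l n.
Proof.
move=> l0 u1 ul1.
have um n k : u n <= u (n + k)%N.
  by elim: k => [|k IH]; rewrite ?addn0 ?lexx// addnS (le_trans IH).
have lm n k : u (n + k)%N + l (n + k)%N <= u n + l n.
  by elim: k => [|k IH]; rewrite ?addn0 ?lexx// addnS (le_trans (ul1 _)).
have ub n m : u m <= u n + l n.
  have := leq_total m n => /orP[/subnKC <-|/subnKC <-].
    by rewrite (le_trans (um m (n - m)%N))// lerDl.
  by rewrite (le_trans _ (lm n (m - n)%N))// lerDl.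
exists (sup (range u)) => n; apply/andP; split.
  apply: ub_le_sup; last by exists n.
  by exists (u 0%N + l 0%N) => _ [m _ <-].
by apply: ge_sup; [exists (u 0%N); exists 0%N | move=> _ [m _ <-]].
Qed.

Section Rectangle.
Variables (G : C -> C) (U V : R -> R -> R) (a b c d : R).
Hypothesis ab : a <= b.
Hypothesis cd : c <= d.
Hypothesis derU : forall x y, a <= x <= b -> c <= y <= d ->
  is_derive y 1 (U x) (Re (G (x +i* y))).
Hypothesis derV : forall x y, a <= x <= b -> c <= y <= d ->
  is_derive x 1 (V y) (Im (G (x +i* y))).
Hypothesis derG : forall x y, a <= x <= b -> c <= y <= d -> cder G (x +i* y).

(* The imaginary part of the contour integral of G along the boundary of the
   rectangle with lower left corner (x, y) and side lengths l and h. *)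
Let J x y l h := (U (x + l) (y + h) - U (x + l) y) - (U x (y + h) - U x y)
  - ((V (y + h) (x + l) - V (y + h) x) - (V y (x + l) - V y x)).

(** Subtract the antiderivatives [U0] and [V0] of the affine approximation of [G]. The remaining
    integrand is at most [e * (l + h)], and the perimeter is [2 * (l + h)]. *)
Lemma contour_linear_approx (x y l h x0 y0 e : R) (k : C) :
  0 <= l -> 0 <= h -> 0 <= e ->
  a <= x -> x + l <= b -> c <= y -> y + h <= d ->
  x <= x0 <= x + l -> y <= y0 <= y + h ->
  (forall s t, x <= s <= x + l -> y <= t <= y + h ->
    normc (G (s +i* t) - G (x0 +i* y0) - k * ((s +i* t) - (x0 +i* y0))) <=
      e * normc ((s +i* t) - (x0 +i* y0))) ->
  `|J x y l h| <= e * (l + h) ^+ 2 *+ 2.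
Proof.
move=> l0 h0 e0 ax xb cy yd /andP[xx0 x0l] /andP[yy0 y0h] Gk.
have D s t : x <= s <= x + l -> y <= t <= y + h ->
    normc (G (s +i* t) - G (x0 +i* y0) - k * ((s +i* t) - (x0 +i* y0))) <=
      e * (l + h).
  move=> hs ht; apply: (le_trans (Gk _ _ hs ht)); apply: ler_wpM2l => //.
  rewrite (le_trans (normc_le_ReIm _))//= lerD// ler_norml; apply/andP;
   move: hs ht => /andP[? ?] /andP[? ?]; split; lra.
pose u s t := Re (G (x0 +i* y0)) + Re k * (s - x0) - Im k * (t - y0).
pose v s t := Im (G (x0 +i* y0)) + Re k * (t - y0) + Im k * (s - x0).
pose U0 s t := (Re (G (x0 +i* y0)) + Re k * (s - x0)) * t
  + (- Im k / 2) * (t - y0) ^+ 2.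
pose V0 t s := (Im (G (x0 +i* y0)) + Re k * (t - y0)) * s
  + Im k / 2 * (s - x0) ^+ 2.
have derU0 (s t : R) : is_derive t 1 (U0 s) (u s t).
  by apply: is_derive_eq (is_derive_quadratic _ _ _ _) _; rewrite /u; field.
have derV0 (s t : R) : is_derive s 1 (V0 t) (v s t).
  by apply: is_derive_eq (is_derive_quadratic _ _ _ _) _; rewrite /v; field.
have vert s : x <= s <= x + l ->
    `|(U s (y + h) - U0 s (y + h)) - (U s y - U0 s y)| <= e * (l + h) * h.
  move=> hs; rewrite -[X in _ * X](addrK y) [h + y]addrC.
  apply: (@derive_bound (fun t => U s t - U0 s t)
    (fun t => Re (G (s +i* t)) - u s t)); first by rewrite lerDl.
  move=> t ht; split.
    apply: is_deriveB; apply: derU.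
      by case/andP: hs => ? ?; apply/andP; split; lra.
    by case/andP: ht => ? ?; apply/andP; split; lra.
  apply: le_trans (D s t hs ht); apply: le_trans (ler_Re_normc _).
  rewrite !(ReB, ReM)/= /u le_eqVlt; apply/orP; left; apply/eqP.
  by congr (`|_|); ring.
have hori t : y <= t <= y + h ->
    `|(V t (x + l) - V0 t (x + l)) - (V t x - V0 t x)| <= e * (l + h) * l.
  move=> ht; rewrite -[X in _ * X](addrK x) [l + x]addrC.
  apply: (@derive_bound (fun s => V t s - V0 t s)
    (fun s => Im (G (s +i* t)) - v s t)); first by rewrite lerDl.
  move=> s hs; split.
    apply: is_deriveB; apply: derV.
      by case/andP: hs => ? ?; apply/andP; split; lra.
    by case/andP: ht => ? ?; apply/andP; split; lra.
  apply: le_trans (D s t hs ht); apply: le_trans (ler_Im_normc _).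
  rewrite !(ImB, ImM)/= /v le_eqVlt; apply/orP; left; apply/eqP.
  by congr (`|_|); ring.
(* The contour sum of the affine part is 0, an identity between polynomials. *)
have -> : J x y l h =
  ((U (x + l) (y + h) - U0 (x + l) (y + h)) - (U (x + l) y - U0 (x + l) y))
  - ((U x (y + h) - U0 x (y + h)) - (U x y - U0 x y))
  - (((V (y + h) (x + l) - V0 (y + h) (x + l)) - (V (y + h) x - V0 (y + h) x))
  - ((V y (x + l) - V0 y (x + l)) - (V y x - V0 y x))).
  by rewrite /J /U0 /V0; field.
have x1 : x <= x <= x + l by apply/andP; split; lra.
have x2 : x <= x + l <= x + l by apply/andP; split; lra.
have y1 : y <= y <= y + h by apply/andP; split; lra.
have y2 : y <= y + h <= y + h by apply/andP; split; lra.
move: (vert _ x1) (vert _ x2) (hori _ y1) (hori _ y2).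
set p1 := _ - _; set p2 := _ - _; set p3 := _ - _; set p4 := _ - _.
move=> q1 q2 q3 q4.
apply: le_trans (ler_normB _ _) _.
apply: le_trans (lerD (ler_normB _ _) (ler_normB _ _)) _.
apply: le_trans (lerD (lerD q2 q1) (lerD q4 q3)) _.
by rewrite le_eqVlt; apply/orP; left; apply/eqP; ring.
Qed.

(** [J] is additive over the four quarters of a rectangle, so some quarter keeps at least a quarter
    of its absolute value. After n bisections the loss is [4 ^ n], and near the limit point the
    affine approximation bounds [J] by an arbitrarily small multiple of [4 ^ (- n)]. *)
Lemma contour_eq0 : J a c (b - a) (d - c) = 0.
Proof.
have two0 n : 0 < (2 : R) ^+ n by rewrite exprn_gt0.
pose L n := (b - a) / 2 ^+ n; pose H n := (d - c) / 2 ^+ n.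
have L0 n : 0 <= L n by rewrite divr_ge0 ?subr_ge0// ltW.
have H0 n : 0 <= H n by rewrite divr_ge0 ?subr_ge0// ltW.
have LS n : L n = L n.+1 + L n.+1.
  by rewrite /L exprS invfM mulrA; field; rewrite gt_eqF.
have HS n : H n = H n.+1 + H n.+1.
  by rewrite /H exprS invfM mulrA; field; rewrite gt_eqF.
pose good l h (q q' : R * R) :=
  [/\ q'.1 = q.1 \/ q'.1 = q.1 + l, q'.2 = q.2 \/ q'.2 = q.2 + h &
    `|J q.1 q.2 (l + l) (h + h)| <= `|J q'.1 q'.2 l h| *+ 4].
have good_ex l h q : exists q', good l h q q'.
  case: q => x y; apply: contrapT => /forallNP ng.
  have n1 := ng (x, y); have n2 := ng (x + l, y).
  have n3 := ng (x, y + h); have n4 := ng (x + l, y + h).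
  have lt q' : (q'.1 = x \/ q'.1 = x + l) -> (q'.2 = y \/ q'.2 = y + h) ->
     ~ good l h (x, y) q' ->
     `|J q'.1 q'.2 l h| *+ 4 < `|J x y (l + l) (h + h)|.
    by move=> h1 h2 ngq; rewrite ltNge; apply/negP => le; apply: ngq.
  have {}n1 := lt (x, y) (or_introl erefl) (or_introl erefl) n1.
  have {}n2 := lt (x + l, y) (or_intror erefl) (or_introl erefl) n2.
  have {}n3 := lt (x, y + h) (or_introl erefl) (or_intror erefl) n3.
  have {}n4 := lt (x + l, y + h) (or_intror erefl) (or_intror erefl) n4.
  have JE : J x y (l + l) (h + h) =
      J x y l h + J (x + l) y l h + (J x (y + h) l h + J (x + l) (y + h) l h).
    by rewrite /J !addrA; ring.
  have := ler_normD (J x y l h + J (x + l) y l h)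
    (J x (y + h) l h + J (x + l) (y + h) l h).
  have := ler_normD (J x y l h) (J (x + l) y l h).
  have := ler_normD (J x (y + h) l h) (J (x + l) (y + h) l h).
  rewrite -JE; move: n1 n2 n3 n4 => /=.
  by rewrite -!(mulr_natr `|J _ _ l h|); lra.
(* The step number is part of the argument because the side lengths depend on it. *)
have /choice[st stP] : forall nq : nat * (R * R), exists q',
    good (L nq.1.+1) (H nq.1.+1) nq.2 q' by move=> nq; apply: good_ex.
pose q := fix q n := if n is m.+1 then st (m, q m) else (a, c).
have qS n : good (L n.+1) (H n.+1) (q n) (q n.+1) by exact: (stP (n, q n)).
have [px pxP] : exists p, forall n, (q n).1 <= p <= (q n).1 + L n.
  apply: nested_intervals => // n.
    by have [[->|->] _ _] := qS n; have := L0 n.+1; lra.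
  by rewrite (LS n); have [[->|->] _ _] := qS n; have := L0 n.+1; lra.
have [py pyP] : exists p, forall n, (q n).2 <= p <= (q n).2 + H n.
  apply: nested_intervals => // n.
    by have [_ [->|->] _] := qS n; have := H0 n.+1; lra.
  by rewrite (HS n); have [_ [->|->] _] := qS n; have := H0 n.+1; lra.
have qab n : a <= (q n).1 /\ (q n).1 + L n <= b.
  elim: n => [|n]; first by rewrite /L expr0 divr1 /=; lra.
  by rewrite (LS n); have [[->|->] _ _] := qS n; have := L0 n.+1; lra.
have qcd n : c <= (q n).2 /\ (q n).2 + H n <= d.
  elim: n => [|n]; first by rewrite /H expr0 divr1 /=; lra.
  by rewrite (HS n); have [_ [->|->] _] := qS n; have := H0 n.+1; lra.
have Jn n : `|J a c (b - a) (d - c)| <=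
    `|J (q n).1 (q n).2 (L n) (H n)| * (2 ^+ n) ^+ 2.
  elim: n => [|n IH]; first by rewrite /L /H expr0 !divr1 expr1n mulr1.
  have [_ _] := qS n; rewrite -LS -HS => Jq.
  apply: (le_trans IH); rewrite [2 ^+ n.+1]exprS exprMn [leRHS]mulrA.
  rewrite ler_wpM2r ?sqr_ge0//.
  by rewrite (_ : 2 ^+ 2 = 4%:R) ?mulr_natr// expr2 -natrM.
apply/eqP; rewrite -normr_le0; apply/ler_addgt0Pr => e e0; rewrite add0r.
set D := (b - a) + (d - c).
have D0 : 0 <= D by rewrite addr_ge0 ?subr_ge0.
(* Chosen so that the final bound [e' * (D ^+ 2 *+ 2)] is at most [e]; the summand 1 covers a
   degenerate rectangle with [D = 0]. *)
pose e' := e / (D ^+ 2 *+ 2 + 1).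
have D21 : 0 < D ^+ 2 *+ 2 + 1 by rewrite ltr_wpDl// mulrn_wge0// sqr_ge0.
have e'0 : 0 < e' by rewrite divr_gt0.
have pab : a <= px <= b.
  have := pxP 0%N; rewrite /= /L expr0 divr1 => /andP[? ?].
  by apply/andP; split; lra.
have pcd : c <= py <= d.
  have := pyP 0%N; rewrite /= /H expr0 divr1 => /andP[? ?].
  by apply/andP; split; lra.
have [k kP] := (cder_epsP _ _).1 (derG pab pcd).
have [r r0 rP] := kP _ e'0.
have [n nr] : exists n, D / 2 ^+ n < r.
  have [n nP] : exists n, D / r < n%:R.
    by exists (Num.bound (D / r)); rewrite archi_boundP// divr_ge0// ltW.
  exists n; rewrite ltr_pdivrMr// mulrC -ltr_pdivrMr//.
  by apply: (lt_trans nP); rewrite -natrX ltr_nat ltn_expl.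
have DE : D / 2 ^+ n = L n + H n by rewrite -mulrDl.
apply: (le_trans (Jn n)).
have [qa qb] := qab n; have [qc qd] := qcd n.
have := @contour_linear_approx (q n).1 (q n).2 (L n) (H n) px py e' k
  (L0 n) (H0 n) (ltW e'0) qa qb qc qd (pxP n) (pyP n).
move=> /(_ _) Jle.
have {}Jle : `|J (q n).1 (q n).2 (L n) (H n)| <= e' * (L n + H n) ^+ 2 *+ 2.
  apply: Jle => s t hs ht; apply: rP.
  apply: le_lt_trans (normc_le_ReIm _) _; apply: le_lt_trans nr.
  rewrite DE /= lerD// ler_norml.
    by have := pxP n; case/andP: hs => ? ? /andP[? ?]; apply/andP; split; lra.
  by have := pyP n; case/andP: ht => ? ? /andP[? ?]; apply/andP; split; lra.
apply: (le_trans (ler_wpM2r (sqr_ge0 _) Jle)).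
rewrite -DE [leLHS](_ : _ = e' * (D ^+ 2 *+ 2)).
  by rewrite /e' mulrAC ler_pdivrMr// ler_wpM2l ?ltW// ltrDl.
by field; rewrite gt_eqF.
Qed.

End Rectangle.

End Goursat.

(** * Exponential, inequality at the centre of a circle, Moebius maps, maximum principle *)

Section MaximumModulus.
Variable R : realType.
Local Notation C := R[i].
Implicit Types (z w p : C).

Lemma is_derive_eps (f : R -> R) (t c : R) : is_derive t 1 f c ->
  forall e, 0 < e -> exists2 d, 0 < d &
    forall h, `|h| < d -> `|f (t + h) - f t - c * h| <= e * `|h|.
Proof.
move=> [df dfc] e e0.
have /cvgRP/(_ e e0) := df; rewrite -/(derive f t 1) dfc near_withinE.
move=> /nbhs_ballP[d /= d0 dP]; exists d => // h hd.
have [->|h0] := eqVneq h 0; first by rewrite addr0 subrr mulr0 subrr normr0 mulr0.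
have bh : ball 0 d h by rewrite /ball /= sub0r normrN.
have /ltW := dP h bh h0.
rewrite /GRing.scale /= mulr1 [h + t]addrC => le.
rewrite (_ : _ - c * h = h * (h^-1 * (f (t + h) - f t) - c)); last by field.
by rewrite normrM mulrC ler_wpM2r.
Qed.

Definition cexp z : C := expR (Re z) * cos (Im z) +i* (expR (Re z) * sin (Im z)).

Lemma cexpD z w : cexp (z + w) = cexp z * cexp w.
Proof.
apply: eqC_ReIm; rewrite ?(ReM, ImM) /= ReD ImD expRD ?cosD ?sinD; ring.
Qed.

Lemma cexp0 : cexp 0 = 1.
Proof. by rewrite /cexp /= expR0 cos0 sin0 mulr1 mulr0. Qed.

Lemma normc_cexp z : normc (cexp z) = expR (Re z).
Proof.
apply/eqP; rewrite -(eqrXn2 (n := 2)) ?normc_ge0 ?expR_ge0//.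
by rewrite sqr_normc_ReIm /= !exprMn -mulrDr cos2Dsin2 mulr1.
Qed.

Lemma cder_cexp0 : cder cexp 0.
Proof.
apply/cder_epsP; exists 1 => e e0.
(* The errors below add up to [7 * (k * N)], which is at most [e * N]; the bound [k <= 1/8] keeps
   [expR x] below 2. *)
pose k := Num.min e 1 / 8.
have k0 : 0 < k by rewrite divr_gt0// lt_min e0 ltr01.
have ke : k * 8 <= e by rewrite /k divfK// ge_min lexx.
have k1 : k * 8 <= 1 by rewrite /k divfK// ge_min lexx orbT.
have [d1 d10 expP] := is_derive_eps (is_derive_expR (0 : R)) k0.
have [d2 d20 cosP] := is_derive_eps (is_derive_cos (0 : R)) k0.
have [d3 d30 sinP] := is_derive_eps (is_derive_sin (0 : R)) k0.
pose d := Num.min k (Num.min d1 (Num.min d2 d3)).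
exists d; first by rewrite !lt_min k0 d10 d20 d30.
move=> z; rewrite !subr0 mul1r cexp0 !lt_min.
move=> /andP[zk /andP[z1 /andP[z2 z3]]].
have Rez := ler_Re_normc z; have Imz := ler_Im_normc z.
have := expP _ (le_lt_trans Rez z1); have := cosP _ (le_lt_trans Imz z2).
have := sinP _ (le_lt_trans Imz z3).
rewrite !add0r expR0 cos0 sin0 oppr0 !mul0r !mul1r subr0 addr0.
set x := Re z; set y := Im z; set N := normc z => siny cosy expx.
have N0 : 0 <= N := normc_ge0 z.
apply: le_trans (normc_le_ReIm _) _; rewrite !(ReB, ImB) /= -/x -/y subr0.
have ex : `|expR x - 1| <= 2 * N.
  have -> : expR x - 1 = (expR x - 1 - x) + x by ring.
  apply: le_trans (ler_normD _ _) _.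
  have : k * `|x| <= 1 * N by apply: ler_pM => //; lra.
  by move: Rez; rewrite -/x -/N; lra.
have ex3 : `|expR x| <= 2.
  have -> : expR x = (expR x - 1) + 1 by ring.
  apply: le_trans (ler_normD _ _) _; rewrite normr1.
  by move: zk; rewrite -/N; lra.
have kx : k * `|x| <= k * N by rewrite ler_wpM2l// ltW.
have ky : k * `|y| <= k * N by rewrite ler_wpM2l// ltW.
have kN : k * N * 8 <= e * N by rewrite mulrAC ler_wpM2r.
have A1 : `|expR x * cos y - 1 - x| <= k * N + 2 * (k * N).
  have -> : expR x * cos y - 1 - x = (expR x - 1 - x) + expR x * (cos y - 1).
    by ring.
  apply: le_trans (ler_normD _ _) _; rewrite lerD ?(le_trans expx)//.
  by rewrite normrM ler_pM// (le_trans cosy).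
have A2 : `|expR x * sin y - y| <= 2 * (k * N) + 2 * (k * N).
  have -> : expR x * sin y - y = expR x * (sin y - y) + (expR x - 1) * y.
    by ring.
  apply: le_trans (ler_normD _ _) _; rewrite !normrM lerD//.
    by rewrite ler_pM// (le_trans siny).
  rewrite [leRHS](_ : _ = 2 * N * k); last by ring.
  apply: ler_pM => //.
  by rewrite (le_trans Imz)// ltW.
have kN0 : 0 <= k * N by rewrite mulr_ge0// ltW.
by apply: le_trans (lerD A1 A2) _; lra.
Qed.

Lemma cder_cexp z : cder cexp z.
Proof.
have h : cder (fun w => cexp z * cexp (w - z)) z.
  apply: cder_mul; first exact: cder_cst.
  apply: cder_comp; first exact: cder_sub (cder_id z) (cder_cst z z).
  by rewrite subrr; exact: cder_cexp0.
by apply: eq_cder h => w; rewrite -cexpD addrC subrK.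
Qed.

Lemma derive_le (W w : R -> R) (a b M : R) : a <= b ->
  (forall t, a <= t <= b -> is_derive t 1 W (w t) /\ w t <= M) ->
  W b - W a <= M * (b - a).
Proof.
move=> ab H.
have [||c cab ->] := @MVT_segment R W w a b ab.
- by move=> x /andP[/ltW ax /ltW xb]; apply: (H x _).1; rewrite ax.
- apply: derivable_within_continuous => x xab.
  by have [? _] := H x xab.
by rewrite ler_wpM2r ?subr_ge0//; exact: (H c cab).2.
Qed.

Lemma cvg_vert (G : C -> C) (x y : R) : cder G (x +i* y) ->
  (G (x +i* t)) @[t --> y] --> G (x +i* y).
Proof.
move=> /cder_continuous Gc.
have xc : (fun=> x) @ y --> x by exact: cvg_cst.
have yc : id @ y --> y by exact: cvg_id.
exact: (cvgC_comp (cvg_Complex xc yc) Gc).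
Qed.

Lemma cvg_hori (G : C -> C) (s : R -> R) (x y : R) : s t @[t --> x] --> s x ->
  cder G (s x +i* y) -> (G (s t +i* y)) @[t --> x] --> G (s x +i* y).
Proof.
move=> sc /cder_continuous Gc.
have yc : (fun=> y) @ x --> y by exact: cvg_cst.
exact: (cvgC_comp (cvg_Complex sc yc) Gc).
Qed.

Section Center.
Variables (F : C -> C) (p : C) (r rho M : R).
Hypotheses (r0 : 0 < r) (rrho : r < rho).
Hypothesis dF : forall w, normc (w - p) < rho -> cder F w.

(** Goursat for [G] on [[a, 0]] times [[0, 2 pi]] compares circles of radii [r * expR a] and [r]:
    the horizontal sides cancel by periodicity, so [Re F] has the same mean on both. The outer mean
    is at most [M], the inner one at least [Re (F p) - e]. *)
Lemma Re_center_le : (forall w, normc (w - p) = r -> Re (F w) <= M) ->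
  Re (F p) <= M.
Proof.
move=> FM; pose G z := F (p + r%:C * cexp z).
have nG z : normc (p + r%:C * cexp z - p) = r * expR (Re z).
  by rewrite addrAC subrr add0r normcM normcR gtr0_norm// normc_cexp.
have dG z : Re z <= 0 -> cder G z.
  move=> z0; apply: (@cder_comp _ F (fun z => p + r%:C * cexp z)).
    apply: cder_add; first exact: cder_cst.
    by apply: cder_mul; [exact: cder_cst | exact: cder_cexp].
  by apply: dF; rewrite nG (le_lt_trans _ rrho)// ler_piMr ?(ltW r0)// -expR0 ler_expR.
(* [G] is controlled only for non-positive real part, whereas antiderivatives are taken of functions
   continuous on the whole line; replacing [x] by [s x] reconciles the two. *)
pose s (x : R) := Num.min x 0.
have s0 (x : R) : s x <= 0 by rewrite ge_min lexx orbT.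
have sE (x : R) : x <= 0 -> s x = x by move=> x0; apply/min_idPl.
have sc (x : R) : s t @[t --> x] --> s x.
  exact: continuous_min (@cvg_id _ _) (cvg_cst _).
have /choice[U derU] : forall x : R, exists U : R -> R,
    forall y : R, -1 < y -> is_derive y 1 U (Re (G (s x +i* y))).
  move=> x; apply: (@antiderivative_gt R (fun y => Re (G (s x +i* y)))) => y.
  exact: (cvg_Re (cvg_vert (dG (s x +i* y) (s0 x)))).
have gV (y n : R) : exists V : R -> R,
    forall x : R, n < x -> is_derive x 1 V (Im (G (s x +i* y))).
  apply: (@antiderivative_gt R (fun x => Im (G (s x +i* y)))) => x.
  exact: (cvg_Im (cvg_hori (sc x) (dG (s x +i* y) (s0 x)))).
apply/ler_addgt0Pr => e e0.
have [d d0 dP] : exists2 d, 0 < d &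
    forall w, normc (w - p) < d -> Re (F p) - e <= Re (F w).
  have Fp : cder F p by apply: dF; rewrite subrr normc0 (lt_trans r0).
  have [d d0 dP] := (cvgC_atP _ _ _).1 (cder_continuous Fp) _ e0.
  exists d => // w /dP /ltW; rewrite -normcN opprB => Fw.
  have := le_trans (ler_norm _) (le_trans (ler_Re_normc _) Fw).
  by rewrite ReB; lra.
(* With this [a] the inner radius is at most [d / 2], and the rectangle lies to the left of 0. *)
pose a := Num.min 0 (ln (d / (2 * r))).
have a0 : a <= 0 by rewrite ge_min lexx.
have ad : r * expR a < d.
  have : expR a <= d / (2 * r).
    rewrite -[leRHS]lnK ?posrE ?divr_gt0 ?mulr_gt0// ler_expR.
    by rewrite ge_min lexx orbT.
  rewrite ler_pdivlMr ?mulr_gt0// => h.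
  have : 0 < r * expR a by rewrite mulr_gt0 ?expR_gt0.
  by move: h; rewrite mulrCA -[expR a * r]mulrC; lra.
have /choice[V derV] := fun y => gV y (a - 1).
have pi2 : 0 <= pi *+ 2 :> R by rewrite mulrn_wge0// pi_ge0.
have H1 (x y : R) : a <= x <= 0 -> 0 <= y <= pi *+ 2 ->
    is_derive y 1 (U x) (Re (G (x +i* y))).
  by move=> /andP[_ x0] /andP[y0 _]; rewrite -{2}(sE x x0); apply: derU; lra.
have H2 (x y : R) : a <= x <= 0 -> 0 <= y <= pi *+ 2 ->
    is_derive x 1 (V y) (Im (G (x +i* y))).
  by move=> /andP[ax x0] _; rewrite -{2}(sE x x0); apply: derV; lra.
have H3 (x y : R) : a <= x <= 0 -> 0 <= y <= pi *+ 2 -> cder G (x +i* y).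
  by move=> /andP[_ x0] _; apply: dG.
have := contour_eq0 a0 pi2 H1 H2 H3.
rewrite sub0r subr0 subrr !add0r.
(* [cexp] has period [2 pi i], so the antiderivatives on the two horizontal sides differ by a
   constant. *)
have -> : V (pi *+ 2) 0 - V (pi *+ 2) a = V 0 0 - V 0 a.
  have H x : a <= x <= 0 -> is_derive x 1 (fun x => V (pi *+ 2) x - V 0 x)
      (Im (G (s x +i* (pi *+ 2))) - Im (G (s x +i* 0))) /\
      `|Im (G (s x +i* (pi *+ 2))) - Im (G (s x +i* 0))| <= 0.
    move=> /andP[ax _]; split.
      by apply: is_deriveB; apply: derV; lra.
    rewrite (_ : G (s x +i* (pi *+ 2)) = G (s x +i* 0)) ?subrr ?normr0//.
    by rewrite /G /cexp /= cos2pi sin2pi cos0 sin0.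
  by have := derive_bound a0 H; rewrite mul0r normr_le0 => /eqP; lra.
move=> UE.
have up : U 0 (pi *+ 2) - U 0 0 <= M * (pi *+ 2 - 0).
  apply: (@derive_le (U 0) (fun y => Re (G (0 +i* y)))) => // y hy; split.
    by apply: H1 => //; rewrite a0 lexx.
  by apply: FM; rewrite nG /= expR0 mulr1.
have lo : - U a (pi *+ 2) - - U a 0 <= - (Re (F p) - e) * (pi *+ 2 - 0).
  apply: (@derive_le (fun y => - U a y) (fun y => - Re (G (a +i* y)))) => //.
  move=> y hy; split.
    by apply: is_deriveN; apply: H1 => //; rewrite a0 lexx.
  by rewrite lerN2; apply: dP; rewrite nG.
have pi20 : 0 < pi *+ 2 :> R by rewrite pmulrn_lgt0// pi_gt0.
rewrite -(ler_pM2r pi20).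
by move: up lo UE; rewrite subr0 !mulNr; lra.
Qed.

End Center.

(** [Re_center_le] is applied to [F] times the constant conjugate of [F p]: its real part at [p] is
    the square of the modulus of [F p], from which one factor cancels. *)
Lemma center_le (F : C -> C) p (r rho M : R) : 0 < r -> r < rho ->
  (forall w, normc (w - p) < rho -> cder F w) ->
  (forall w, normc (w - p) = r -> normc (F w) <= M) -> normc (F p) <= M.
Proof.
move=> r0 rrho dF FM.
have M0 : 0 <= M.
  apply: le_trans (normc_ge0 _) (FM (p + r%:C) _).
  by rewrite addrAC subrr add0r normcR gtr0_norm.
have ReJ w : Re (w * w^*) = normc w ^+ 2.
  by rewrite sqr_normc_ReIm; case: w => x y /=; ring.
have := @Re_center_le (fun w => F w * (F p)^*) p r rho (M * normc (F p)) r0 rrho.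
rewrite ReJ => /(_ _ _) H.
have {}H : normc (F p) ^+ 2 <= M * normc (F p).
  apply: H => w hw.
    by apply: cder_mul; [exact: dF | exact: cder_cst].
  apply: le_trans (ler_norm _) _; apply: le_trans (ler_Re_normc _) _.
  by rewrite normcM normcJ ler_wpM2r ?normc_ge0// FM.
have [->//|n0] := eqVneq (normc (F p)) 0.
move: H; rewrite expr2 ler_pM2r//.
by rewrite lt_def n0 normc_ge0.
Qed.

Section Moebius.
Implicit Types (a : C).

(** The automorphism of the disc that sends 0 to [a], with inverse [moebius (- a)]. The quotient in
    the theorem is [moebius (- z) w]. *)
Definition moebius a z := (z + a) / (1 + a^* * z).

Lemma moebius_den_neq0 a z : normc a < 1 -> normc z <= 1 -> 1 + a^* * z != 0.
Proof.
move=> a1 z1; apply/negP; rewrite addr_eq0 => /eqP az.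
have : normc (a^* * z) = 1 by rewrite -[_ * _]opprK -az normcN normc1.
rewrite normcM normcJ; apply/eqP; rewrite lt_eqF//.
by rewrite (le_lt_trans _ a1)// ler_piMr// normc_ge0.
Qed.

Lemma moebius_identity a z : normc a < 1 -> normc z <= 1 ->
  (1 - normc (moebius a z) ^+ 2) * normc (1 + a^* * z) ^+ 2 =
  (1 - normc a ^+ 2) * (1 - normc z ^+ 2).
Proof.
move=> a1 z1; have d0 := moebius_den_neq0 a1 z1.
have n0 : normc (1 + a^* * z) != 0 by rewrite normc_eq0.
rewrite /moebius normcM normcV exprMn exprVn mulrBl mul1r divfK ?expf_neq0//.
rewrite !sqr_normc_ReIm !(ReD, ImD, ReM, ImM) /=.
by case: a {a1 d0 n0} => x y; case: z {z1} => s t /=; ring.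
Qed.

Lemma moebius_lt1 a z : normc a < 1 -> normc z < 1 -> normc (moebius a z) < 1.
Proof.
move=> a1 z1; have d0 := moebius_den_neq0 a1 (ltW z1).
have n0 : 0 < normc (1 + a^* * z) ^+ 2 by rewrite exprn_gt0// normc_gt0.
have : 0 < (1 - normc (moebius a z) ^+ 2) * normc (1 + a^* * z) ^+ 2.
  by rewrite moebius_identity ?ltW// mulr_gt0// subr_gt0 expr_lt1// normc_ge0.
by rewrite pmulr_lgt0// subr_gt0 expr_lt1// normc_ge0.
Qed.

Lemma moebiusK a z : normc a < 1 -> normc z < 1 ->
  moebius (- a) (moebius a z) = z.
Proof.
move=> a1 z1; have d0 := moebius_den_neq0 a1 (ltW z1).
have a1' : normc (- a) < 1 by rewrite normcN.
have := moebius_den_neq0 a1' (ltW (moebius_lt1 a1 z1)).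
rewrite /moebius (_ : (- a)^* = - a^*); last by case: a {a1 d0 a1'}.
move=> d1.
have aa : 1 - a * a^* != 0.
  rewrite subr_eq0; apply: contraTneq a1 => /(congr1 (@normc R)).
  rewrite normcM normcJ normc1 -leNgt => aa1; rewrite -(expr_ge1 (n := 2))//.
    by rewrite expr2 -aa1.
  exact: normc_ge0.
move: d0 aa; set b := a^*; clearbody b => d0 aa.
by field; rewrite d0 (_ : 1 + b * z + _ = 1 - a * b) ?aa//; ring.
Qed.

Lemma cder_moebius a z : normc a < 1 -> normc z <= 1 -> cder (moebius a) z.
Proof.
move=> a1 z1; apply: cder_div; last exact: moebius_den_neq0.
  by apply: cder_add; [exact: cder_id | exact: cder_cst].
apply: cder_add; first exact: cder_cst.
by apply: cder_mul; [exact: cder_cst | exact: cder_id].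
Qed.

End Moebius.

(** Composition with the Moebius map sending 0 to [p] makes [p] the centre. A circle of radius [t]
    close to 1 is mapped into the annulus where [F] is bounded, and [center_le] applies to it. *)
Lemma maximum_modulus_annulus (F : C -> C) (r M : R) p : r < 1 ->
  (forall w, normc w < 1 -> cder F w) ->
  (forall w, r < normc w < 1 -> normc (F w) <= M) ->
  normc p < 1 -> normc (F p) <= M.
Proof.
move=> r1 dF FM p1.
have [pr|rp] := leP (normc p) r; last by apply: FM; rewrite rp.
have r0 : 0 <= r := le_trans (normc_ge0 _) pr.
have FpE : F p = (fun z => F (moebius p z)) 0.
  by rewrite /moebius mulr0 add0r addr0 divr1.
have p2 : normc p ^+ 2 < 1 by rewrite expr_lt1// normc_ge0.
have r2 : r ^+ 2 < 1 by rewrite expr_lt1.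
(* If a point of the circle of radius [t] went to modulus at most [r], the left side of
   [moebius_identity] would be at least [A]; its right side is at most [1 - t ^+ 2], which is set to
   [A / 2]. *)
pose A := (1 - r ^+ 2) * (1 - normc p) ^+ 2.
have A0 : 0 < A by rewrite mulr_gt0 ?exprn_gt0 ?subr_gt0.
have A1 : A <= 1.
  apply: mulr_ile1; [lra|exact: sqr_ge0|by have := sqr_ge0 r; lra|].
  by rewrite expr_le1 ?subr_ge0 ?(ltW p1)// gerBl normc_ge0.
pose t := Num.sqrt (1 - A / 2).
have t2 : t ^+ 2 = 1 - A / 2 by rewrite sqr_sqrtr//; lra.
have t0 : 0 < t by rewrite sqrtr_gt0; lra.
have t1 : t < 1 by rewrite -(expr_lt1 (n := 2))// ?t2 ?ltW//; lra.
rewrite FpE; apply: (@center_le (fun z => F (moebius p z)) 0 t 1 M) => //.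
  move=> w; rewrite subr0 => w1; apply: cder_comp.
    by apply: cder_moebius => //; apply: ltW.
  by apply: dF; apply: moebius_lt1.
move=> w; rewrite subr0 => wt; have w1 : normc w < 1 by rewrite wt.
apply: FM; rewrite moebius_lt1// andbT.
rewrite -(ltr_pXn2r (n := 2)) ?nnegrE ?normc_ge0//.
have den : (1 - normc p) ^+ 2 <= normc (1 + p^* * w) ^+ 2.
  rewrite ler_pXn2r// ?nnegrE ?subr_ge0 ?normc_ge0 ?(ltW p1)//.
  have := lerB_normc 1 (- (p^* * w)); rewrite opprK normcN normc1 normcM normcJ.
  by apply: le_trans; rewrite lerB// ler_piMr ?normc_ge0// ltW.
have den0 : 0 < (1 - normc p) ^+ 2 by rewrite exprn_gt0// subr_gt0.
have := moebius_identity p1 (ltW w1); rewrite wt t2.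
rewrite (_ : 1 - (1 - A / 2) = A / 2) => [idt|]; last by lra.
rewrite ltNge; apply/negP => le.
have : (1 - r ^+ 2) * (1 - normc p) ^+ 2 <=
    (1 - normc (moebius p w) ^+ 2) * normc (1 + p^* * w) ^+ 2.
  by rewrite ler_pM ?subr_ge0 ?lerB// ?sqr_ge0// ltW.
rewrite idt -/A => h.
have : (1 - normc p ^+ 2) * (A / 2) <= 1 * (A / 2).
  by rewrite ler_wpM2r ?gerBl ?sqr_ge0// divr_ge0// ltW.
by lra.
Qed.

End MaximumModulus.

(** * Uniqueness of continuous square roots; the principal root *)

Section SquareRoots.
Variable R : realType.
Local Notation C := R[i].

Lemma connected_locally_constant (T : topologicalType) (A P : set T) (x : T) :
  connected A ->
  (forall t, A t -> \forall s \near t, A s -> (P s <-> P t)) ->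
  A x -> P x -> forall t, A t -> P t.
Proof.
move=> cA loc Ax Px; suff <- : A `&` P = A by move=> t [].
apply: cA; first by exists x.
- exists ([set t | A t -> P t]^°)%classic; first exact: open_interior.
  apply/seteqP; split=> t [At].
    move=> Pt; split=> //; rewrite /interior.
    by apply: filterS (loc t At) => s Ps /Ps[_]; apply.
  by move=> /nbhs_singleton /(_ At).
- exists (~` ([set t | A t -> ~ P t]^°))%classic.
    exact/open_closedC/open_interior.
  apply/seteqP; split=> t [At].
    by move=> Pt; split=> // /nbhs_singleton /(_ At).
  move=> nP; split=> //; apply: contrapT => nPt; apply: nP; rewrite /interior.
  by apply: filterS (loc t At) => s Ps /Ps [Pst _] /Pst.
Qed.

Lemma cvg_withinW (T : topologicalType) (A : set T) (f : T -> C) (t : T) (l : C) :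
  f s @[s --> t] --> l -> f s @[s --> within A (nbhs t)] --> l.
Proof.
move=> fl U /fl fU; exact: (@filterS _ (nbhs t) _ (f @^-1` U) _ (fun s Us _ => Us) fU).
Qed.

(** At each point [f = g] or [f = - g]. Accordingly [f + g] or [f - g] takes the value [2 * f t], is
    non-zero nearby, and so excludes the other sign in a neighbourhood. *)
Lemma sqrt_unique (T : topologicalType) (A : set T) (f g : T -> C) (x : T) :
  connected A ->
  (forall t, A t -> f s @[s --> within A (nbhs t)] --> f t) ->
  (forall t, A t -> g s @[s --> within A (nbhs t)] --> g t) ->
  (forall t, A t -> f t ^+ 2 = g t ^+ 2) ->
  (forall t, A t -> f t != 0) ->
  A x -> f x = g x -> forall t, A t -> f t = g t.
Proof.
move=> cA fc gc fg f0; apply: connected_locally_constant => // t At.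
have ft2 : f t + f t != 0 by rewrite -mulr2n -mulr_natr mulf_neq0 ?f0 ?pnatr_eq0.
have n0 : 0 < normc (f t + f t) by rewrite normc_gt0.
have /eqP := fg t At; rewrite eqf_sqr => /orP[/eqP ftg|/eqP ftg].
  pose proof (cvgC_add (fc t At) (gc t At)) as h; rewrite -ftg in h.
  move/cvgCP: h => /(_ _ n0); rewrite near_withinE.
  apply: filterS => s sP As; split=> // _.
  have /eqP := fg s As; rewrite eqf_sqr => /orP[/eqP//|/eqP sg].
  by have := sP As; rewrite sg addNr sub0r normcN ltxx.
have gtE : - g t = f t by [].
pose proof (cvgC_sub (fc t At) (gc t At)) as h; rewrite gtE in h.
move/cvgCP: h => /(_ _ n0); rewrite near_withinE.
apply: filterS => s sP As; split=> [sg|tg].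
  by have := sP As; rewrite sg subrr sub0r normcN ltxx.
by move: ft2; rewrite {1}ftg -tg addNr eqxx.
Qed.

Lemma connected01 : connected (`[0, 1]%classic : set R).
Proof. exact: segment_connected. Qed.

Lemma cvg_segment (c w : C) (t : R) :
  (c + s%:C * (w - c)) @[s --> t] --> c + t%:C * (w - c).
Proof.
have tc : id @ t --> t by exact: cvg_id.
exact: (cvgC_add (cvgC_cst c)
  (cvgC_mul (@cvg_realC _ _ _ _ id t%:C tc erefl) (cvgC_cst (w - c)))).
Qed.

Arguments cvg_segment c w t : clear implicits.

Lemma normc_segment (c w : C) (t : R) : 0 <= t <= 1 ->
  normc (c + t%:C * (w - c) - c) <= normc (w - c).
Proof.
move=> /andP[t0 t1]; rewrite addrAC subrr add0r normcM normcR ger0_norm//.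
by rewrite ler_piMl// normc_ge0.
Qed.

(** Restriction to the radii reduces the claim to the connectedness of [[0, 1]]. *)
Lemma sqrt_unique_disc (f g : C -> C) (c : C) (e : R) :
  (forall w, normc (w - c) < e -> [/\ f u @[u --> w] --> f w,
    g u @[u --> w] --> g w, f w ^+ 2 = g w ^+ 2 & f w != 0]) ->
  f c = g c -> forall w, normc (w - c) < e -> f w = g w.
Proof.
move=> fg fgc w we; pose p (t : R) : C := c + t%:C * (w - c).
have pe t : `[0, 1]%classic t -> normc (p t - c) < e.
  by rewrite /= in_itv /= => t01; apply: le_lt_trans we; exact: normc_segment.
have p1 : p 1 = w by rewrite /p mul1r addrC subrK.
have p0 : p 0 = c by rewrite /p mul0r addr0.
rewrite -p1; apply: (@sqrt_unique R `[0, 1]%classic (f \o p) (g \o p) 0).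
- exact: connected01.
- move=> t /pe /fg[fc _ _ _].
  exact: (@cvg_withinW R _ _ _ _ (cvgC_comp (cvg_segment c w t) fc)).
- move=> t /pe /fg[_ gc _ _].
  exact: (@cvg_withinW R _ _ _ _ (cvgC_comp (cvg_segment c w t) gc)).
- by move=> t /pe /fg[].
- by move=> t /pe /fg[].
- by rewrite /= in_itv /= lexx ler01.
- by rewrite /= p0.
- by rewrite /= in_itv /= lexx ler01.
Qed.

(* The principal square root off the negative half-line: the square of
   [w + |w|] is [w] times [2 (|w| + Re w)]. *)
Definition psqrt (w : C) : C :=
  (w + (normc w)%:C) / (Num.sqrt (2 * (normc w + Re w)))%:C.

Lemma psqrt_sqr (w : C) : 0 < Re w -> psqrt w ^+ 2 = w.
Proof.
move=> w0; have n0 : 0 < 2 * (normc w + Re w).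
  by rewrite mulr_gt0// ltr_wpDl// normc_ge0.
have n1 : (2 * (normc w + Re w))%:C != 0 :> C.
  by rewrite -normc_gt0 normcR normr_gt0 gt_eqF.
rewrite /psqrt exprMn exprVn -rmorphXn /= sqr_sqrtr ?ltW//.
apply: (mulIf n1); rewrite divfK//.
have := sqr_normc_ReIm w; case: w {w0 n0 n1} => x y; set N := normc _ => /= NE.
apply: eqC_ReIm; rewrite !expr2 /=; last by ring.
by rewrite !mulr0 !addr0 !subr0; move: NE; rewrite !expr2; lra.
Qed.

Lemma psqrt_continuous (w : C) : 0 < Re w -> psqrt u @[u --> w] --> psqrt w.
Proof.
move=> w0; have n0 : 0 < 2 * (normc w + Re w).
  by rewrite mulr_gt0// ltr_wpDl// normc_ge0.
have n1 : (Num.sqrt (2 * (normc w + Re w)))%:C != 0 :> C.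
  by rewrite -normc_gt0 normcR normr_gt0 gt_eqF// sqrtr_gt0.
have nc : normc u @[u --> w] --> normc w by exact: (cvg_normc (cvgC_id w)).
have rc : Re u @[u --> w] --> Re w by exact: (cvg_Re (cvgC_id w)).
have sc : (2 * (normc u + Re u)) @[u --> w] --> 2 * (normc w + Re w).
  exact: (cvgR_mul (cvgR_cst 2) (cvgR_add nc rc)).
have qc : Num.sqrt (2 * (normc u + Re u)) @[u --> w] -->
    Num.sqrt (2 * (normc w + Re w)).
  exact: (cvgR_comp sc (@sqrt_continuous R _)).
have nC : (normc u)%:C @[u --> w] --> (normc w)%:C.
  exact: (@cvg_realC R C (nbhs w) _ _ (normc w)%:C nc erefl).
have qC : (Num.sqrt (2 * (normc u + Re u)))%:C @[u --> w] -->
    (Num.sqrt (2 * (normc w + Re w)))%:C.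
  exact: (@cvg_realC R C (nbhs w) _ _ (Num.sqrt _)%:C qc erefl).
exact: (cvgC_mul (cvgC_add (cvgC_id w) nC) (cvgC_inv n1 qC)).
Qed.

Lemma Re_gt0_near1 (w : C) : normc (w - 1) < 1 -> 0 < Re w.
Proof.
move=> w1; have := le_lt_trans (ler_Re_normc _) w1.
by rewrite ReB /= ltr_norml => /andP[+ _]; lra.
Qed.

End SquareRoots.
Arguments cvg_segment {R} c w t.

(** * Extension across removable sets; chains of every mesh join no two points of K *)

Section RemovableSets.
Variable R : realType.
Local Notation C := R[i].

Lemma hausdorff_C : hausdorff_space C.
Proof. exact: norm_hausdorff. Qed.

Lemma compact_far (K : set C) (z : C) : compact K -> ~ K z ->
  exists2 e, 0 < e & forall k, K k -> e <= normc (z - k).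
Proof.
move=> cK Kz; have /openCP oK : open (~` K).
  exact: (closed_openC (compact_closed hausdorff_C cK)).
have [e e0 eP] := oK z Kz; exists e => // k Kk; rewrite leNgt; apply/negP.
by rewrite normcB => /eP.
Qed.

Lemma compact_in_disc (K : set C) : compact K -> K `<=` unit_disc ->
  exists2 r, r < 1 & forall k, K k -> normc k <= r.
Proof.
move=> cK KD; have [K0|/set0P/negP] := pselect (K !=set0); last first.
  by rewrite negbK => /eqP ->; exists 0.
have nc : {within K, continuous (@normc R)}.
  apply: continuous_subspaceT => z.
  exact: (cvg_normc (cvgC_id z)).
have [c /set_mem Kc cP] := compact_EVT_max K0 cK nc.
by exists (normc c) => [|k Kk]; [exact: KD | apply: cP; exact: mem_set].
Qed.

Lemma holomorphicP (U : set C) (f : C -> C) :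
  holomorphic_on U f <-> (forall z, U z -> cder f z).
Proof. by split=> h z /h /derivable_cder. Qed.

Lemma boundedC (A : set C) (f : C -> C) (M : R) :
  (forall z, A z -> normc (f z) <= M) -> [bounded f z | z in A].
Proof.
move=> fM; exists M%:C; split; first by apply/complex_realP; exists M.
move=> B MB z Az; rewrite /= normr_normc; apply: le_trans (ltW MB).
by rewrite lecR fM.
Qed.

Lemma removable_extension (K U : set C) (f : C -> C) (M : R) : removable K ->
  open U -> K `<=` U ->
  (forall z, (U `\` K) z -> cder f z) ->
  (forall z, (U `\` K) z -> normc (f z) <= M) ->
  exists2 g, forall z, U z -> cder g z & forall z, (U `\` K) z -> g z = f z.
Proof.
move=> [_ rK] oU KU df fM.
have [||g gd gE] := rK U oU KU f; first exact/holomorphicP.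
  exact: boundedC fM.
by exists g => //; exact/holomorphicP.
Qed.

Lemma open_unit_disc : open (@unit_disc R).
Proof.
apply/openCP => z z1; exists (1 - normc z); first by rewrite subr_gt0.
move=> w wz; rewrite /unit_disc /= -(subrK z w) (le_lt_trans (ler_normcD _ _))//.
by rewrite -ltrBrDr.
Qed.

(** A compact subset of the disc lies in a smaller disc, so the hypothesis bounds [F] on an annulus.
    With [M = 0] this serves as the identity theorem across [K]. *)
Lemma maximum_modulus (K : set C) (F : C -> C) (M : R) (p : C) :
  compact K -> K `<=` unit_disc ->
  (forall z, unit_disc z -> cder F z) ->
  (forall z, (unit_disc `\` K) z -> normc (F z) <= M) ->
  unit_disc p -> normc (F p) <= M.
Proof.
move=> cK KD dF FM; have [r r1 rP] := compact_in_disc cK KD.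
apply: (maximum_modulus_annulus r1) => // w /andP[rw w1]; apply: FM; split=> //.
by move=> /rP; rewrite leNgt rw.
Qed.

Inductive chain (K : set C) (d : R) (a : C) : C -> Prop :=
| chain_refl : chain K d a a
| chain_step b c : chain K d a b -> K c -> normc (b - c) < d -> chain K d a c.

Lemma chain_in (K : set C) d a b : K a -> chain K d a b -> K b.
Proof. by move=> Ka; case. Qed.

Lemma chain_le (K : set C) d d' a b : d <= d' -> chain K d a b -> chain K d' a b.
Proof.
move=> dd'; elim=> [|b' c _ ih Kc bc]; first exact: chain_refl.
exact: chain_step ih Kc (lt_le_trans bc dd').
Qed.

(** For consecutive points [b'] and [c] of the chain, [(z - b') / (z - c)] differs from 1 by
    [(c - b') / (z - c)], of modulus below 1 when [z] is at distance at least [d] from [K]. The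
    principal root is continuous there, and the product of the quotients telescopes. *)
Lemma chain_sqrt (K : set C) (d : R) (a b : C) : K a -> chain K d a b ->
  exists S : C -> C, forall z, (forall k, K k -> d <= normc (z - k)) ->
    z != a -> z != b ->
    (S w @[w --> z] --> S z) /\ S z ^+ 2 = (z - a) / (z - b).
Proof.
move=> Ka; elim=> [|b' c cab [S SP] Kc bc].
  exists (fun=> 1) => z _ za _; split; first exact: (@cvgC_cst _ _ (nbhs z)).
  by rewrite divff ?subr_eq0// expr1n.
have Kb := chain_in Ka cab.
pose q z := (z - b') / (z - c).
exists (fun z => S z * psqrt (q z)) => z zK za zc.
have d0 : 0 < d by apply: le_lt_trans bc; exact: normc_ge0.
have zb : z != b'.
  by have := lt_le_trans d0 (zK _ Kb); rewrite normc_gt0 subr_eq0.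
have [Sc SE] := SP z zK za zb.
have zc0 : z - c != 0 by rewrite subr_eq0.
have zb0 : z - b' != 0 by rewrite subr_eq0.
have qz : 0 < Re (q z).
  apply: Re_gt0_near1; have -> : q z - 1 = (c - b') / (z - c).
    by rewrite /q; field.
  rewrite normcM normcV ltr_pdivrMr ?normc_gt0// mul1r normcB.
  exact: lt_le_trans bc (zK _ Kc).
have qc : q w @[w --> z] --> q z.
  exact: (cvgC_mul (cvgC_sub (cvgC_id z) (cvgC_cst b'))
    (cvgC_inv zc0 (cvgC_sub (cvgC_id z) (cvgC_cst c)))).
split; first exact: (cvgC_mul Sc (cvgC_comp qc (psqrt_continuous qz))).
by rewrite exprMn SE psqrt_sqr// /q; field; rewrite zc0.
Qed.

Lemma inv_nat_lt (e : R) : 0 < e -> exists N, forall n, (N <= n)%N ->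
  n.+1%:R^-1 <= e.
Proof.
move=> e0; exists (Num.bound e^-1) => n Nn.
rewrite invf_ple ?posrE ?ltr0n//.
have : e^-1 < (Num.bound e^-1)%:R by rewrite archi_boundP// invr_ge0 ltW.
by move/ltW/le_trans; apply; rewrite ler_nat (leq_trans Nn).
Qed.

Section NoChain.
Variables (K : set C) (a b : C).
Hypotheses (rK : removable K) (KD : K `<=` unit_disc).
Hypothesis domO : domain (unit_disc `\` K).
Hypotheses (Ka : K a) (Kb : K b) (ab : a != b).
Hypothesis ch : forall d, 0 < d -> chain K d a b.

Let q (z : C) : C := (z - a) / (z - b).

(* The roots [S n] given by chains of mesh 1/(n+1) exist off a shrinking
   neighbourhood of K, up to a sign on each component. Normalised at a base
   point they eventually agree at every point, because eventual agreement is a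
   locally constant property on a connected set. *)
Lemma chain_sqrt_complement : exists (T : C -> C) (c : C), c != 0 /\ forall z,
  (unit_disc `\` K) z -> (T w @[w --> z] --> T z) /\ T z ^+ 2 = q z / c.
Proof.
have [oO cO [z0 Oz0]] := domO.
have /choice[S SP] : forall n : nat, exists S : C -> C, forall z,
    (forall k, K k -> n.+1%:R^-1 <= normc (z - k)) -> z != a -> z != b ->
    (S w @[w --> z] --> S z) /\ S z ^+ 2 = q z.
  by move=> n; apply: (chain_sqrt Ka (ch _)); rewrite invr_gt0 ltr0n.
have V z : (unit_disc `\` K) z -> exists2 e, 0 < e & exists N, forall n,
    (N <= n)%N -> forall w, normc (w - z) < e ->
    [/\ S n u @[u --> w] --> S n w, S n w ^+ 2 = q w & S n w != 0].
  move=> [_ Kz]; have [e e0 eP] := compact_far (proj1 rK) Kz.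
  have e20 : 0 < e / 2 by rewrite divr_gt0.
  have [N NP] := inv_nat_lt e20.
  exists (e / 2) => //; exists N => n /NP ne w wz.
  have wk k : K k -> e / 2 <= normc (w - k).
    move=> /eP ek; have := ler_normcB (w - k) (w - z).
    by rewrite (_ : w - k - _ = z - k); [lra | ring].
  have wne k : K k -> w != k.
    move=> /wk wk0; rewrite -subr_eq0 -normc_gt0; exact: lt_le_trans wk0.
  have [Sc SE] := SP n w (fun k Kk => le_trans ne (wk k Kk)) (wne a Ka) (wne b Kb).
  split=> //; rewrite -sqrf_eq0 SE mulf_neq0 ?invr_eq0 ?subr_eq0 ?wne//.
have [e0 e00 [n0 n0P]] := V z0 Oz0.
have Sz0 n : (n0 <= n)%N -> S n z0 ^+ 2 = q z0 /\ S n z0 != 0.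
  by move=> nn; have [] := n0P n nn z0; rewrite ?subrr ?normc0.
(* The division fixes the value 1 at [z0], so the roots can be compared across [n]; their squares
   become [q z / q z0], whence the constant [c]. *)
pose T n z := S n z / S n z0.
have loc z : (unit_disc `\` K) z -> exists2 e, 0 < e & exists N,
    [/\ (n0 <= N)%N, forall n, (N <= n)%N -> T n u @[u --> z] --> T n z
    & forall n m, (N <= n)%N -> (N <= m)%N ->
    forall w, normc (w - z) < e -> (T n w = T m w <-> T n z = T m z)].
  move=> /V[e ep [N NP]]; exists e => //; exists (maxn n0 N).
  split=> [|n|n m]; rewrite ?leq_maxl// !geq_max.
    move=> /andP[_ /NP/(_ z)]; rewrite subrr normc0 => /(_ ep)[Sc _ _].
    exact: (cvgC_mul Sc (cvgC_cst _)).
  move=> /andP[n0n Nn] /andP[n0m Nm] w we.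
  have [_ Sn0] := Sz0 n n0n; have [_ Sm0] := Sz0 m n0m.
  have zz : normc (z - z) < e by rewrite subrr normc0.
  have [_ SnE Snz] := NP n Nn z zz; have [_ SmE Smz] := NP m Nm z zz.
  pose k := S n z / S m z.
  have SE u : normc (u - z) < e -> S n u = k * S m u.
    apply: (@sqrt_unique_disc R (S n) (fun v => k * S m v)); last by rewrite /k divfK.
    move=> v ve; have [Snc Sn2 Sn00] := NP n Nn v ve.
    have [Smc Sm2 Sm00] := NP m Nm v ve.
    split; [exact: Snc | exact: (cvgC_mul (cvgC_cst k) Smc) | | exact: Sn00].
    by rewrite exprMn Sn2 Sm2 /k expr_div_n SnE SmE divff ?mul1r// -SnE expf_neq0.
  (* [S n] is a constant multiple [k] of [S m] on the disc, so agreement of [T n] and [T m] at [u]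
     amounts to a condition in which [u] does not occur. *)
  have TE u : normc (u - z) < e -> (T n u = T m u <-> k / S n z0 = (S m z0)^-1).
    move=> ue; have [_ _ Smu] := NP m Nm u ue.
    rewrite /T SE// -mulrA mulrCA; split=> [|->//].
    exact: (mulfI Smu).
  by split=> /TE h; apply/TE => //; apply: h.
have PT : forall z, (unit_disc `\` K) z ->
    exists N, forall n m, (N <= n)%N -> (N <= m)%N -> T n z = T m z.
  apply: (connected_locally_constant cO _ Oz0) => [z /loc[e ep [N [_ _ NP]]]|].
    apply/nbhsCP; exists e => // w we _.
    split=> -[N' N'P]; exists (maxn N N') => n m;
      rewrite !geq_max => /andP[Nn N'n] /andP[Nm N'm].
      by apply/(NP n m Nn Nm w we); apply: N'P.
    by apply/(NP n m Nn Nm w we); apply: N'P.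
  by exists n0 => n m /Sz0[_ ?] /Sz0[_ ?]; rewrite /T !divff.
have /choice[L LP] : forall z, exists c, (unit_disc `\` K) z ->
    exists N, forall n, (N <= n)%N -> T n z = c.
  move=> z; have [Oz|nO] := pselect ((unit_disc `\` K) z); last by exists 0.
  by have [N NP] := PT z Oz; exists (T N z) => _; exists N => n Nn; apply: NP.
exists L, (q z0); split.
  by have [<- ?] := Sz0 n0 (leqnn _); rewrite expf_neq0.
move=> z Oz; have [e ep [N [n0N Tc NP]]] := loc z Oz.
(* Past [N] agreement spreads from [z] to the disc of radius [e], past [N1] it holds at [z]. So
   [T M] equals the limit [L] on a whole neighbourhood, and [L] inherits its continuity. *)
have [N1 N1P] := PT z Oz; pose M := maxn N N1.
have LE w : normc (w - z) < e -> (unit_disc `\` K) w -> T M w = L w.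
  move=> we Ow; have [N2 N2P] := LP w Ow.
  rewrite -(N2P (maxn M N2)) ?leq_maxr//.
  have NM : (N <= M)%N by rewrite leq_maxl.
  have N1M : (N1 <= M)%N by rewrite leq_maxr.
  have MM : (M <= maxn M N2)%N by rewrite leq_maxl.
  apply/(NP _ _ NM (leq_trans NM MM) w we).
  by apply: N1P => //; exact: leq_trans MM.
have LzE : T M z = L z by apply: LE; rewrite ?subrr ?normc0.
split.
  rewrite -LzE; apply: (@cvgC_near _ _ (nbhs z) _ (T M)); last first.
    by apply: Tc; rewrite leq_maxl.
  have [d d0 dP] := (openCP _).1 oO z Oz.
  apply/nbhsCP; exists (Num.min e d); first by rewrite lt_min ep d0.
  by move=> w; rewrite lt_min => /andP[we /dP]; exact: LE.
have [e' e'0 [N' N'P]] := V z Oz; have [N2 N2P] := LP z Oz.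
pose n := maxn n0 (maxn N' N2).
have nn0 : (n0 <= n)%N by rewrite leq_maxl.
have nN' : (N' <= n)%N by rewrite /n maxnCA leq_maxl.
have nN2 : (N2 <= n)%N by rewrite /n maxnA leq_maxr.
rewrite -(N2P n nN2) /T expr_div_n; have [-> _] := Sz0 n nn0.
by have [|_ -> _] := N'P n nN' z; rewrite ?subrr ?normc0.
Qed.

(** The factor [z - b] clears the pole of [T] at [b], so that [sig] is bounded and extends. At [a]
    the square of the extension has a simple zero, with cofactor [(z - b) / c] non-zero since
    [a != b]. *)
Lemma chain_contra : False.
Proof.
have [T [c [c0 TP]]] := chain_sqrt_complement.
have [oO _ _] := domO.
have ne z k : ~ K z -> K k -> z - k != 0.
  by move=> Kz Kk; rewrite subr_eq0; apply: contra_notN Kz => /eqP ->.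
have dT z : (unit_disc `\` K) z -> cder T z.
  move=> Oz; have [Tc T2] := TP z Oz; have [_ Kz] := Oz.
  apply: (@cder_sqrt R T (fun z => q z / c)) => //.
  - by rewrite -sqrf_eq0 T2 /q !mulf_neq0 ?invr_eq0 ?ne.
  - have [d d0 dP] := (openCP _).1 oO z Oz.
    by apply/nbhsCP; exists d => // w /dP /TP[].
  - apply: cder_mul; last exact: cder_cst.
    apply: cder_div; last exact: ne.
      exact: cder_sub (cder_id z) (cder_cst a z).
    exact: cder_sub (cder_id z) (cder_cst b z).
pose sig z := (z - b) * T z.
have sig2 z : (unit_disc `\` K) z -> sig z ^+ 2 = (z - a) * ((z - b) / c).
  move=> Oz; have [_ T2] := TP z Oz; have [_ Kz] := Oz.
  by rewrite /sig exprMn T2 /q; field; rewrite c0 ne.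
(* Both [z - a] and [z - b] have modulus at most 2, so the square of [sig] is at most [4 / normc c];
   the bound on [sig] itself follows from [x <= 1 + x ^+ 2]. *)
have [|z Oz|g gd gE] := @removable_extension K unit_disc sig (1 + 4 / normc c) rK
    open_unit_disc KD.
- move=> z Oz; apply: cder_mul; last exact: dT.
  exact: cder_sub (cder_id z) (cder_cst b z).
- have [z1 Kz] := Oz.
  have x2 : normc (sig z) ^+ 2 <= 4 / normc c.
    rewrite -normcX sig2// !normcM normcV mulrA ler_wpM2r ?invr_ge0 ?normc_ge0//.
    rewrite (_ : 4 = 2 * 2); last by rewrite -natrM.
    rewrite ler_pM ?normc_ge0// (le_trans (ler_normcB _ _))//;
      rewrite (_ : 2 = 1 + 1)// lerD// ltW//; [exact: KD | exact: KD].
  have := sqr_ge0 (normc (sig z) - 1); have := normc_ge0 (sig z).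
  by move: x2; rewrite !expr2; set x := normc (sig z); nra.
have gE2 z : unit_disc z -> g z ^+ 2 = (z - a) * ((z - b) / c).
  move=> Dz; apply/eqP; rewrite -subr_eq0 -normc_eq0 eq_le normc_ge0 andbT.
  apply: (@maximum_modulus K (fun z => g z ^+ 2 - (z - a) * ((z - b) / c)))=> //.
  - exact: (proj1 rK).
  - move=> w Dw; apply: cder_sub; first by apply: cder_exp; exact: gd.
    apply: cder_mul; first exact: cder_sub (cder_id w) (cder_cst a w).
    apply: cder_mul; last exact: cder_cst.
    exact: cder_sub (cder_id w) (cder_cst b w).
  - by move=> w Ow; rewrite gE// sig2// subrr normc0.
have := @sqr_simple_zero R g (fun z => (z - b) / c) a (gd a (KD Ka)).
have kc : ((z - b) / c) @[z --> a] --> (a - b) / c.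
  exact: (cvgC_mul (cvgC_sub (cvgC_id a) (cvgC_cst b)) (cvgC_cst _)).
move=> /(_ kc) h; have /eqP : (a - b) / c = 0.
  apply: h; have [d d0 dP] := (openCP _).1 open_unit_disc a (KD Ka).
  by apply/nbhsCP; exists d => // w /dP /gE2.
by rewrite mulf_eq0 invr_eq0 subr_eq0 (negPf ab) (negPf c0).
Qed.

End NoChain.

End RemovableSets.

(** * No continuous root of z - w around a point w of K *)

Section LocalSquareRoot.
Variable R : realType.
Local Notation C := R[i].
Variable K : set C.
Hypotheses (rK : removable K) (KD : K `<=` unit_disc).
Hypothesis domO : domain (unit_disc `\` K).

(** [K1] is the set of points chained to [w] with mesh [1/(n+1)]. If each of these sets left the
    disc of radius [e], a cluster point of escaping points would differ from [w] and be chained to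
    it at every mesh, against [chain_contra]. *)
Lemma removable_small_clopen (w : C) (e : R) : K w -> 0 < e ->
  exists (K1 : set C) (d : R), [/\ 0 < d, K1 w, K1 `<=` K,
    forall k, K1 k -> normc (k - w) < e &
    forall a b, K1 a -> K b -> ~ K1 b -> d <= normc (a - b)].
Proof.
move=> Kw e0; apply: contrapT => nK1.
have inv0 n : 0 < n.+1%:R^-1 :> R by rewrite invr_gt0 ltr0n.
have /choice[b bP] : forall n : nat, exists b,
    chain K n.+1%:R^-1 w b /\ e <= normc (b - w).
  move=> n; apply: contrapT => /forallNP nb; apply: nK1.
  exists [set b | chain K n.+1%:R^-1 w b], n.+1%:R^-1; split=> //.
  - exact: chain_refl.
  - by move=> k; apply: chain_in.
  - by move=> k chk; rewrite ltNge; apply/negP => ek; apply: (nb k).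
  - move=> a c cha Kc nchc; rewrite leNgt; apply/negP => ac.
    by apply: nchc; exact: chain_step ac.
have bK n : K (b n) by have [/(chain_in Kw)] := bP n.
have [p [Kp clp]] : exists p, K p /\ cluster (b @ \oo) p.
  have [|p [? ?]] := proj1 rK (b @ \oo) _; last by exists p.
  by exists 0%N => // n _; exact: bK.
have near_p d : 0 < d -> exists n, n.+1%:R^-1 <= d /\ normc (b n - p) < d.
  move=> d0; have [N NP] := inv_nat_lt d0.
  have bN : (b @ \oo) (b @` [set n | (N <= n)%N]).
    by exists N => // n Nn; exists n.
  have [_ [[n Nn <-] nd]] := clp _ _ bN (nbhsC_disc p d0).
  by exists n; split=> //; apply: NP.
apply: (@chain_contra R K w p) => //.
  have [n [_ np]] := near_p e e0; have [_ /(lt_le_trans np)] := bP n.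
  by apply: contraTneq => <-; rewrite ltxx.
move=> d d0; have [n [nd np]] := near_p d d0; have [chn _] := bP n.
exact: chain_step (chain_le nd chn) Kp np.
Qed.

Lemma no_local_sqrt (w : C) (V : set C) (s : C -> C) : K w -> open V -> V w ->
  (forall z, (V `\` K) z -> (s u @[u --> z] --> s z) /\ s z ^+ 2 = z - w) ->
  False.
Proof.
move=> Kw /openCP oV /oV[e e0 eV] sP.
have [K1 [d [d0 K1w K1K K1e K1d]]] := removable_small_clopen Kw e0.
have d20 : 0 < d / 2 by rewrite divr_gt0.
(* Half the gap between [K1] and the rest of [K]: the neighbourhoods [U1] and [U2] built from it are
   disjoint. *)
pose near_set (A : set C) := [set z | exists2 a, A a & normc (z - a) < d / 2].
have oN A : open (near_set A).
  apply/openCP => z [a Aa za]; exists (d / 2 - normc (z - a)).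
    by rewrite subr_gt0.
  move=> u uz; exists a => //; have := ler_normcD (u - z) (z - a).
  by rewrite subrKA; lra.
pose U1 := near_set K1 `&` [set z | normc (z - w) < e].
pose U2 := near_set (K `\` K1).
have oE : open [set z | normc (z - w) < e].
  apply/openCP => z /= zw; exists (e - normc (z - w)); first by rewrite subr_gt0.
  by move=> u uz; have := ler_normcD (u - z) (z - w); rewrite subrKA; lra.
have oU1 : open U1 by apply: openI.
have U1V : U1 `<=` V by move=> z [_ /eV].
have K1U : K1 `<=` U1.
  by move=> k K1k; split; [exists k => //; rewrite subrr normc0 | exact: K1e].
have U12 z : U1 z -> U2 z -> False.
  move=> [[a K1a za] _] [b [Kb nK1b] zb].
  have := K1d a b K1a Kb nK1b; have := ler_normcB (z - b) (z - a).
  by rewrite (_ : z - b - _ = a - b); [lra | ring].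
have K_U1 z : K z -> U1 z -> K1 z.
  move=> Kz [[a K1a za] _]; apply: contrapT => nK1z.
  by have := K1d a z K1a Kz nK1z; rewrite normcB; lra.
have oVK : open (V `\` K).
  rewrite setDE; apply: openI; first by apply/openCP.
  exact: (closed_openC (compact_closed (@hausdorff_C R) (proj1 rK))).
have ds z : (V `\` K) z -> cder s z.
  move=> Oz; have [sc s2] := sP z Oz.
  apply: (@cder_sqrt R s (fun u => u - w)) => //.
  - rewrite -sqrf_eq0 s2 subr_eq0; case: Oz => _.
    by apply: contra_notN => /eqP ->.
  - have [r r0 rP] := (openCP _).1 oVK z Oz.
    by apply/nbhsCP; exists r => // u /rP /sP[].
  - exact: cder_sub (cder_id z) (cder_cst w z).
pose f z := if `[< U1 z >] then s z else 0.
have U1_near (z : C) (P : C -> Prop) : U1 z -> (forall u, U1 u -> P u) ->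
    \forall u \near z, P u.
  move=> U1z UP; have [r r0 rP] := (openCP _).1 oU1 z U1z.
  by apply/nbhsCP; exists r => // u /rP /UP.
(* On [U1] the square of [s] has modulus below [e], and [x <= 1 + x ^+ 2] turns this into the bound
   [1 + e]. *)
have [|||z|g gd gE] := @removable_extension R K (U1 `|` U2) f (1 + e) rK.
- exact: openU oU1 (oN _).
- move=> k Kk; have [K1k|nK1k] := pselect (K1 k); first by left; exact: K1U.
  by right; exists k => //; rewrite subrr normc0.
- move=> z [[U1z|U2z] nKz].
    apply: (@cder_near R s); last by apply: ds; split=> //; exact: U1V.
    by apply: U1_near => // u U1u; rewrite /f asboolT.
  apply: (@cder_near R (fun=> 0)); last exact: cder_cst.
  have [r r0 rP] := (openCP _).1 (oN _) z U2z.
  apply/nbhsCP; exists r => // u /rP U2u; rewrite /f asboolF// => U1u.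
  exact: U12 U1u U2u.
- move=> [_ nKz]; rewrite /f; case: asboolP => [U1z|_]; last first.
    by rewrite normc0 addr_ge0// ltW.
  have [_ s2] := sP z (conj (U1V _ U1z) nKz); have [_ /= zw] := U1z.
  have : normc (s z) ^+ 2 < e by rewrite -normcX s2.
  have := sqr_ge0 (normc (s z) - 1); have := normc_ge0 (s z).
  by rewrite !expr2; set x := normc (s z); nra.
(* The identity [g z ^+ 2 = z - w] is wanted on [U1], where the maximum principle for the disc does
   not apply directly. Cut off by 0 the difference is differentiable everywhere: a point outside
   [U1] lies either in [U2] or off [K], and [F] vanishes near it. *)
pose F z := if `[< U1 z >] then g z ^+ 2 - (z - w) else 0.
have F0 z : ~ K z -> F z = 0.
  move=> nKz; rewrite /F; case: asboolP => // U1z.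
  rewrite gE; last by split=> //; left.
  rewrite /f asboolT//; have [_ ->] := sP z (conj (U1V _ U1z) nKz).
  by rewrite subrr.
have dF z : cder F z.
  have [U1z|nU1z] := pselect (U1 z).
    apply: (@cder_near R (fun u => g u ^+ 2 - (u - w))).
      by apply: U1_near => // u U1u; rewrite /F asboolT.
    apply: cder_sub; first by apply: cder_exp; apply: gd; left.
    exact: cder_sub (cder_id z) (cder_cst w z).
  apply: (@cder_near R (fun=> 0)); last exact: cder_cst.
  have [Kz|nKz] := pselect (K z).
    have U2z : U2 z.
      exists z; last by rewrite subrr normc0.
      by split=> // /K1U.
    have [r r0 rP] := (openCP _).1 (oN _) z U2z.
    apply/nbhsCP; exists r => // u /rP U2u; rewrite /F asboolF// => U1u.
    exact: U12 U1u U2u.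
  have [r r0 rP] := compact_far (proj1 rK) nKz.
  apply/nbhsCP; exists r => // u ur; rewrite F0// => /rP.
  by rewrite normcB leNgt ur.
have F_eq0 z : unit_disc z -> F z = 0.
  move=> Dz; apply/eqP; rewrite -normc_eq0 eq_le normc_ge0 andbT.
  apply: (@maximum_modulus R K F) => //; first exact: (proj1 rK).
  by move=> u [_ nKu]; rewrite F0// normc0.
have U1w : U1 w by exact: K1U.
have : (1 : C) = 0.
  apply: (@sqr_simple_zero R g (fun=> 1) w).
  - by apply: gd; left.
  - exact: (@cvgC_cst _ _ (nbhs w)).
  have oUD : open (U1 `&` unit_disc) by apply: openI => //; exact: open_unit_disc.
  have [r r0 rP] := (openCP _).1 oUD w (conj U1w (KD Kw)).
  apply/nbhsCP; exists r => // u /rP[U1u Du]; rewrite mulr1.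
  by have := F_eq0 u Du; rewrite /F asboolT// => /eqP; rewrite subr_eq0 => /eqP.
by apply/eqP; rewrite oner_eq0.
Qed.

End LocalSquareRoot.

(** * Clamping to the unit interval; square roots on the unit square *)

Section Lifting.
Variable R : realType.
Local Notation C := R[i].

(** A continuous retraction onto the unit interval. Composed with it, a function continuous within
    the interval or the square becomes continuous everywhere, so limits need no subspace
    topology. *)
Definition clamp (t : R) : R := Num.max 0 (Num.min 1 t).

Lemma clamp_itv t : 0 <= clamp t <= 1.
Proof. by rewrite /clamp le_max lexx /= ge_max ler01 ge_min lexx. Qed.

Lemma clamp_unit t : unit_interval (clamp t).
Proof. by rewrite /unit_interval /= in_itv /= clamp_itv. Qed.

Lemma clamp_id t : 0 <= t <= 1 -> clamp t = t.
Proof.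
by move=> /andP[t0 t1]; rewrite /clamp (min_idPr t1) (max_idPr t0).
Qed.

Lemma clamp_le0 t : t <= 0 -> clamp t = 0.
Proof.
by move=> t0; rewrite /clamp (min_idPr (le_trans t0 ler01)) (max_idPl t0).
Qed.

Lemma clamp_ge1 t : 1 <= t -> clamp t = 1.
Proof. by move=> t1; rewrite /clamp (min_idPl t1) (max_idPr ler01). Qed.

Lemma clamp_lip s t : `|clamp s - clamp t| <= `|s - t|.
Proof.
have H x y : x <= y -> 0 <= clamp y - clamp x <= y - x.
  move=> xy; have [x0|x0] := leP x 0; have [y0|y0] := leP y 0.
  - by rewrite !clamp_le0//; lra.
  - have [y1|y1] := leP 1 y; first by rewrite (clamp_le0 x0) clamp_ge1//; lra.
    by rewrite (clamp_le0 x0) clamp_id ?(ltW y0) ?(ltW y1)//; lra.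
  - by lra.
  have [x1|x1] := leP 1 x; have [y1|y1] := leP 1 y.
  - by rewrite !clamp_ge1//; lra.
  - by lra.
  - by rewrite (clamp_id (t := x)) ?(ltW x0) ?(ltW x1)// clamp_ge1//; lra.
  - by rewrite !clamp_id ?(ltW x0) ?(ltW y0) ?(ltW x1) ?(ltW y1)//; lra.
have [st|/ltW ts] := leP s t.
  have := H s t st => /andP[h1 h2].
  by rewrite distrC ger0_norm// (distrC s) ger0_norm ?subr_ge0.
have := H t s ts => /andP[h1 h2].
by rewrite ger0_norm// ger0_norm ?subr_ge0.
Qed.

Lemma clamp_continuous t : clamp s @[s --> t] --> clamp t.
Proof.
apply/(@cvgRP R R (nbhs t)) => e e0; apply/nbhs_ballP; exists e => // s.
by rewrite /ball /= distrC; apply: le_lt_trans; exact: clamp_lip.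
Qed.

Definition unit_square : set (R * R) := [set p | 0 <= p.1 <= 1 /\ 0 <= p.2 <= 1].

Lemma unit_squareE : @unit_interval R `*` @unit_interval R = unit_square.
Proof. by apply/seteqP; split=> -[s t]; rewrite /unit_interval /= !in_itv. Qed.

Lemma compact_unit_square : compact unit_square.
Proof.
by rewrite -unit_squareE; apply: compact_setX; exact: segment_compact.
Qed.

Lemma square_uniform (h : R * R -> C) (e : R) :
  (forall p, h q @[q --> p] --> h p) -> 0 < e ->
  exists2 d, 0 < d & forall p, unit_square p -> forall q,
    `|q.1 - p.1| < d -> `|q.2 - p.2| < d -> normc (h q - h p) < e.
Proof.
move=> hc e0; have e20 : 0 < e / 2 by rewrite divr_gt0.
have := (compact_near_coveringP _).1 compact_unit_square R (0^'+)
  (fun d p => forall q, `|q.1 - p.1| < d -> `|q.2 - p.2| < d ->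
     normc (h q - h p) < e) _.
case=> [p _|].
  have /cvgCP/(_ _ e20)/nbhs_ballP[d /= d0 dP] := hc p.
  have d20 : 0 < d / 2 by rewrite divr_gt0.
  exists (ball p (d / 2), [set x | x < d / 2]) => /=.
    by split; [exact: nbhsx_ballx | exact: nbhs_right_lt].
  move=> [p' x] /= [[pp1 pp2] xd] q q1 q2.
  have b1 : ball p d p'.
    by split; [apply: le_ball pp1 | apply: le_ball pp2]; lra.
  have b2 : ball p d q.
    move: pp1 pp2; rewrite /ball /= => pp1 pp2.
    split; rewrite /ball /=.
      have := ler_normD (p.1 - p'.1) (p'.1 - q.1).
      by rewrite subrKA (distrC p'.1); lra.
    have := ler_normD (p.2 - p'.2) (p'.2 - q.2).
    by rewrite subrKA (distrC p'.2); lra.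
  have := ler_normcB (h q - h p) (h p' - h p).
  rewrite (_ : _ - _ - _ = h q - h p'); last by ring.
  by have := dP _ b1; have := dP _ b2; lra.
move=> d /= d0 dP; exists (d / 2); first by rewrite divr_gt0.
move=> p sp q; apply: (dP (d / 2)) => //; last by rewrite divr_gt0.
by rewrite /ball /= sub0r normrN gtr0_norm ?divr_gt0//; lra.
Qed.

Lemma psqrt1 : psqrt 1 = 1 :> C.
Proof.
rewrite /psqrt normc1 /= (_ : 2 * (1 + 1) = 2 ^+ 2); last by rewrite expr2.
rewrite sqrtr_sqr ger0_norm// (_ : 1 + 1%:C = (2%:C : C)).
  by rewrite divff// -normc_gt0 normcR normr_gt0 pnatr_eq0.
by apply: eqC_ReIm => /=; rewrite ?addr0.
Qed.

(** The square is star-shaped about the origin. Along the ray to [p], the value [h p] is [h (0, 0)]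
    times the quotients of consecutive values at [j p / n]; for large [n] these lie within 1 of 1,
    and principal roots of them are multiplied. *)
Lemma square_sqrt (h : R * R -> C) :
  (forall p, h q @[q --> p] --> h p) -> (forall p, h p != 0) ->
  exists S : R * R -> C, forall p, unit_square p ->
    (S q @[q --> p] --> S p) /\ S p ^+ 2 = h p.
Proof.
move=> hc h0.
have sq0 : unit_square !=set0 by exists (0, 0); rewrite /unit_square /= lexx ler01.
have nc : {within unit_square, continuous (fun p => normc (h p))}.
  by apply: continuous_subspaceT => p; exact: (cvg_normc (hc p)).
have [p0 _ p0P] := compact_EVT_min sq0 compact_unit_square nc.
have m0 : 0 < normc (h p0) by rewrite normc_gt0.
have [d d0 dP] := square_uniform hc m0.
have [N NP] := inv_nat_lt (divr_gt0 d0 (ltr0n R 2)).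
pose n := N.+1; have n0 : n%:R != 0 :> R by rewrite pnatr_eq0.
(* Points [j p / n] and [(j + 1) p / n] are less than [d] apart in each coordinate, so [h] varies
   between them by less than its minimal modulus on the square. *)
have nd : n%:R^-1 < d by have := NP N (leqnn _); rewrite -/n; lra.
pose sc (x : R) (p : R * R) := (x * p.1, x * p.2).
have scc x p : sc x q @[q --> p] --> sc x p.
  have f1 : q.1 @[q --> p] --> p.1 by exact: cvg_fst.
  have f2 : q.2 @[q --> p] --> p.2 by exact: cvg_snd.
  exact: (cvg_pair (cvgR_mul (cvgR_cst x) f1) (cvgR_mul (cvgR_cst x) f2)).
suff : forall j, (j <= n)%N -> exists S : R * R -> C, forall p, unit_square p ->
    (S q @[q --> p] --> S p) /\ S p ^+ 2 = h (sc (j%:R / n%:R) p).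
  move=> /(_ n (leqnn _))[S SP]; exists S => p sp; have [Sc ->] := SP p sp.
  by split; [exact: Sc | rewrite divff// /sc !mul1r -surjective_pairing].
elim=> [|j IH] jn.
  exists (fun=> sqrtc (h (0, 0))) => p _; split.
    exact: (@cvgC_cst _ _ (nbhs p)).
  by rewrite sqr_sqrtc /sc !mul0r.
have [S SP] := IH (ltnW jn).
pose u (k : nat) p := h (sc (k%:R / n%:R) p).
exists (fun p => S p * psqrt (u j.+1 p / u j p)) => p sp.
have [Sc SE] := SP p sp.
have uc k : u k q @[q --> p] --> u k p by move=> U /hc /scc.
have scI k : (k <= n)%N -> unit_square (sc (k%:R / n%:R) p).
  move=> kn; have k1 : k%:R / n%:R <= 1 :> R.
    by rewrite ler_pdivrMr ?ltr0n// mul1r ler_nat.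
  have k0 : 0 <= k%:R / n%:R :> R by rewrite divr_ge0.
  by move: sp => [/andP[? ?] /andP[? ?]]; split; rewrite /= mulr_ge0//= mulr_ile1.
have un x : 0 <= x <= 1 -> `|j.+1%:R / n%:R * x - j%:R / n%:R * x| < d.
  move=> /andP[x0 x1]; rewrite -mulrBl -mulrBl -natr1 addrAC subrr add0r mul1r.
  rewrite ger0_norm ?mulr_ge0 ?invr_ge0//; apply: le_lt_trans nd.
  by rewrite ler_piMr// invr_ge0.
have rpos : 0 < Re (u j.+1 p / u j p).
  apply: Re_gt0_near1.
  have -> : u j.+1 p / u j p - 1 = (u j.+1 p - u j p) / u j p.
    by rewrite mulrBl divff// h0.
  rewrite normcM normcV ltr_pdivrMr ?normc_gt0 ?h0// mul1r.
  apply: lt_le_trans (p0P _ (mem_set (scI j (ltnW jn)))).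
  by move: sp => [s1 s2]; apply: dP (scI j (ltnW jn)) _ _ _; exact: un.
have uq : (u j.+1 q / u j q) @[q --> p] --> u j.+1 p / u j p.
  exact: (cvgC_mul (uc _) (cvgC_inv (h0 _) (uc _))).
split; first exact: (cvgC_mul Sc (cvgC_comp uq (psqrt_continuous rpos))).
by rewrite exprMn SE psqrt_sqr// mulrCA -/(u j p) divff ?h0// mulr1.
Qed.

End Lifting.
Arguments unit_square {R}.
Arguments clamp_continuous {R} t.

(** * Monodromy of square roots on a simply connected set *)

Section Monodromy.
Variable R : realType.
Local Notation C := R[i].
Variables (A : set C) (h : C -> C).
Hypothesis hc : forall z, A z -> h w @[w --> z] --> h z.
Hypothesis h0 : forall z, A z -> h z != 0.

(** A path in [A] with a continuous root of [h] along it. Both are defined on the whole line, which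
    clamping allows; the endpoints are at 0 and 1. *)
Definition lift (g s : R -> C) := forall t,
  [/\ g u @[u --> t] --> g t, A (g t), s u @[u --> t] --> s t
    & s t ^+ 2 = h (g t)].

Lemma clamp0 : clamp 0 = 0 :> R. Proof. by rewrite clamp_le0. Qed.
Lemma clamp1 : clamp 1 = 1 :> R. Proof. by rewrite clamp_ge1. Qed.

Lemma cvg_clamp (g : R -> C) t : {within @unit_interval R, continuous g} ->
  g (clamp u) @[u --> t] --> g (clamp t).
Proof.
move=> /subspace_continuousP/(_ _ (clamp_unit t)) gc U /gc.
move=> Ug.
have {}Ug : nbhs (clamp t) (fun u => unit_interval u -> U (g u)) by exact: Ug.
pose proof (clamp_continuous t _ Ug) as Vg.
exact: (@filterS _ (nbhs t) _ _ _ (fun u Hu => Hu (clamp_unit u)) Vg).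
Qed.

(** [square_sqrt] is applied to a function of the second coordinate alone; the factor
    [c / S (0, 0)], of square 1, corrects the initial sign. *)
Lemma path_lift (g : R -> C) (c : C) :
  (forall t, g u @[u --> t] --> g t) -> (forall t, A (g t)) ->
  c ^+ 2 = h (g 0) ->
  exists s, lift (fun t => g (clamp t)) s /\ s 0 = c.
Proof.
move=> gc gA c2.
have hgc (p : R * R) : h (g q.2) @[q --> p] --> h (g p.2).
  have f2 : q.2 @[q --> p] --> p.2 by exact: cvg_snd.
  by move=> U /(hc (gA _)) /gc /f2.
have [S SP] := @square_sqrt R (fun p : R * R => h (g p.2)) hgc
  (fun p => h0 (gA _)).
have sq t : unit_square (0 : R, clamp t).
  by split; rewrite /= ?lexx ?ler01// clamp_itv.
have S0 : S (0, 0) ^+ 2 = h (g 0).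
  by have [_] := SP _ (sq 0); rewrite clamp0.
exists (fun t => S (0, clamp t) * (c / S (0, 0))); split; last first.
  rewrite clamp0 mulrC divfK//; rewrite -sqrf_eq0 S0; exact: h0.
move=> t; have [Sc S2] := SP _ (sq t); split.
- by move=> U /gc; exact: clamp_continuous.
- exact: gA.
- have pc : (0 : R, clamp u) @[u --> t] --> (0 : R, clamp t).
    exact: (cvg_pair (cvgR_cst 0) (clamp_continuous t)).
  have Sc' : S (0, clamp u) @[u --> t] --> S (0, clamp t).
    by move=> U /Sc /pc.
  exact: (cvgC_mul Sc' (cvgC_cst _)).
- by rewrite exprMn S2 /= expr_div_n c2 S0 divff ?mulr1 ?h0.
Qed.

(* Written as a sum of clamped halves, the concatenation is continuous without
   any gluing argument. *)
Lemma concat_lift (g1 s1 g2 s2 : R -> C) : lift g1 s1 -> lift g2 s2 ->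
  g1 1 = g2 0 -> s1 1 = s2 0 ->
  exists g s, [/\ lift g s, g 0 = g1 0, g 1 = g2 1, s 0 = s1 0 & s 1 = s2 1].
Proof.
move=> l1 l2 g12 s12.
pose a (t : R) := clamp (t *+ 2); pose b (t : R) := clamp (t *+ 2 - 1).
have ac t : a u @[u --> t] --> a t.
  have dbl : (u + u) @[u --> t] --> t + t.
    by exact: (cvgR_add (@cvg_id _ (nbhs t)) (@cvg_id _ (nbhs t))).
  by move=> U /clamp_continuous /dbl.
have bc t : b u @[u --> t] --> b t.
  have dbl : (u + u + -1) @[u --> t] --> t + t + -1.
    by exact: (cvgR_add (cvgR_add (@cvg_id _ (nbhs t)) (@cvg_id _ (nbhs t))) (cvgR_cst _)).
  by move=> U /clamp_continuous /dbl.
(* Either the second half has not started or the first is finished. In [cat] the idle path then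
   cancels against the common point [f1 1 = f2 0]. *)
have ab t : (b t = 0) \/ (a t = 1).
  have [t1|t1] := leP (t *+ 2) 1; [left|right].
    by rewrite /b clamp_le0// subr_le0.
  by rewrite /a clamp_ge1// ltW.
pose cat (f1 f2 : R -> C) t := f1 (a t) + f2 (b t) - f1 1.
have catE (f1 f2 : R -> C) t : f1 1 = f2 0 ->
    (cat f1 f2 t = f1 (a t) /\ b t = 0) \/ (cat f1 f2 t = f2 (b t) /\ a t = 1).
  move=> f12; rewrite /cat; have [bt|at1] := ab t; [left|right].
    by rewrite bt -f12 addrK.
  by rewrite at1 addrAC subrr add0r.
have a0 : a 0 = 0 by rewrite /a mul0rn clamp0.
have b0 : b 0 = 0 by rewrite /b mul0rn sub0r clamp_le0// lerN10.
have a1 : a 1 = 1 by rewrite /a clamp_ge1// ler1n.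
have b1 : b 1 = 1 by rewrite /b mulr2n addrK clamp1.
have cat0 (f1 f2 : R -> C) : f1 1 = f2 0 -> cat f1 f2 0 = f1 0.
  by move=> f12; rewrite /cat a0 b0 f12 addrK.
have cat1 (f1 f2 : R -> C) : cat f1 f2 1 = f2 1.
  by rewrite /cat a1 b1 addrAC subrr add0r.
exists (cat g1 g2), (cat s1 s2); rewrite !cat0// !cat1.
split; [|exact: erefl|exact: erefl|exact: erefl|exact: erefl].
move=> t; have [c1 A1 d1 e1] := l1 (a t); have [c2 A2 d2 e2] := l2 (b t).
split.
- have c1' : g1 (a u) @[u --> t] --> g1 (a t) by move=> U /c1 /ac.
  have c2' : g2 (b u) @[u --> t] --> g2 (b t) by move=> U /c2 /bc.
  exact: (cvgC_sub (cvgC_add c1' c2') (cvgC_cst _)).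
- by have [[-> _]|[-> _]] := catE g1 g2 t g12.
- have d1' : s1 (a u) @[u --> t] --> s1 (a t) by move=> U /d1 /ac.
  have d2' : s2 (b u) @[u --> t] --> s2 (b t) by move=> U /d2 /bc.
  exact: (cvgC_sub (cvgC_add d1' d2') (cvgC_cst _)).
- have [bt|at1] := ab t.
    by rewrite /cat bt -g12 -s12 !addrK.
  by rewrite /cat at1 [s1 1 + _]addrC addrK [g1 1 + _]addrC addrK.
Qed.

(** The sign [k] allows the reversed root to be matched with the end of another lift over the same
    endpoint. *)
Lemma reverse_lift (g s : R -> C) (k : C) : lift g s -> k ^+ 2 = 1 ->
  lift (fun t => g (1 - t)) (fun t => k * s (1 - t)).
Proof.
move=> l k2 t; have [c1 A1 d1 e1] := l (1 - t).
have rc : (1 - u) @[u --> t] --> 1 - t.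
  have nc : (- u) @[u --> t] --> - t by exact: cvgN.
  exact: (cvgR_add (cvgR_cst 1) nc).
split.
- by move=> U /c1 /rc.
- exact: A1.
- have d1' : s (1 - u) @[u --> t] --> s (1 - t) by move=> U /d1 /rc.
  exact: (cvgC_mul (cvgC_cst k) d1').
- by rewrite exprMn k2 mul1r.
Qed.

Hypothesis scA : simply_connected A.

(** Take a root [S] of [h] along the null-homotopy. Three sides of the square go to the base point,
    where [S] is constant by uniqueness of roots, so [S] agrees at the two ends of the fourth side;
    there it is a constant multiple of [s]. *)
Lemma loop_lift (g s : R -> C) : lift g s -> g 0 = g 1 -> s 0 = s 1.
Proof.
move=> l g01.
have [||H [Hc HA H1 H2]] := scA.2 g _ _ g01.
- by apply: continuous_subspaceT => t; have [gc _ _ _] := l t; exact: gc.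
- by move=> _ [t _ <-]; have [_ At _ _] := l t; exact: At.
pose cl (p : R * R) := (clamp p.1, clamp p.2).
have clsq p : unit_square (cl p) by split; exact: clamp_itv.
have clU p : (@unit_interval R `*` @unit_interval R) (cl p).
  by rewrite unit_squareE.
have clc (p : R * R) : cl q @[q --> p] --> cl p.
  have f1 : q.1 @[q --> p] --> p.1 by exact: cvg_fst.
  have f2 : q.2 @[q --> p] --> p.2 by exact: cvg_snd.
  have g1 : clamp q.1 @[q --> p] --> clamp p.1.
    by move=> U /clamp_continuous /f1.
  have g2 : clamp q.2 @[q --> p] --> clamp p.2.
    by move=> U /clamp_continuous /f2.
  exact: (cvg_pair g1 g2).
have Hcl (p : R * R) : H (cl q) @[q --> p] --> H (cl p).
  move: Hc => /subspace_continuousP/(_ _ (clU p)) Hc U /Hc UH.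
  have {}UH : nbhs (cl p) (fun q =>
      (@unit_interval R `*` @unit_interval R) q -> U (H q)) by exact: UH.
  pose proof (clc p _ UH) as VH.
  exact: (@filterS _ (nbhs p) _ _ _ (fun q Hq => Hq (clU q)) VH).
have HAcl p : A (H (cl p)) by apply: HA; exists (cl p).
have hHc (p : R * R) : h (H (cl q)) @[q --> p] --> h (H (cl p)).
  by move=> U /(hc (HAcl p)) /Hcl.
have [S SP] := square_sqrt hHc (fun p => h0 (HAcl p)).
have edge (p : R -> R * R) (k : R -> C) :
    (forall t, p u @[u --> t] --> p t) ->
    (forall t, unit_interval t -> unit_square (p t)) ->
    (forall t, unit_interval t -> k u @[u --> t] --> k t) ->
    (forall t, unit_interval t -> h (H (cl (p t))) = k t ^+ 2) ->
    S (p 0) = k 0 -> S (p 1) = k 1.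
  move=> pc psq kc kE Sk.
  have u1 : `[0, 1]%classic (1 : R) by rewrite /= in_itv /= lexx ler01.
  have u0 : `[0, 1]%classic (0 : R) by rewrite /= in_itv /= lexx ler01.
  apply: (@sqrt_unique R R `[0, 1]%classic (fun t => S (p t)) k 0).
  - exact: connected01.
  - move=> t ut; have [Sc _] := SP _ (psq t ut).
    have Sc' : S (p u) @[u --> t] --> S (p t) by move=> U /Sc /pc.
    exact: (@cvg_withinW R R _ _ _ _ Sc').
  - by move=> t ut; exact: (@cvg_withinW R R _ _ _ _ (kc t ut)).
  - by move=> t ut; have [_ ->] := SP _ (psq t ut); exact: kE.
  - move=> t ut; rewrite -sqrf_eq0; have [_ ->] := SP _ (psq t ut).
    exact: h0.
  - exact: u0.
  - exact: Sk.
  - exact: u1.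
have u0 : unit_interval (0 : R) by rewrite /unit_interval /= in_itv /= lexx ler01.
have u1 : unit_interval (1 : R) by rewrite /unit_interval /= in_itv /= lexx ler01.
have itv (t : R) : unit_interval t -> 0 <= t <= 1.
  by rewrite /unit_interval /= in_itv.
have clE s' t : unit_interval s' -> unit_interval t -> cl (s', t) = (s', t).
  by move=> /itv hs /itv ht; rewrite /cl /= !clamp_id.
have i1 : ((0 : R) <= 1) && ((1 : R) <= 1) by rewrite lexx ler01.
have i0 : ((0 : R) <= 0) && ((0 : R) <= 1) by rewrite lexx ler01.
have S00 : S (0, 0) ^+ 2 = h (g 0).
  have [_ ->] := SP (0, 0) (conj i0 i0).
  by rewrite clE//; have [-> _] := H1 0 u0.
have idc (t : R) : u @[u --> t] --> t by exact: cvg_id.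
have cc (c : C) (t : R) : c @[_ --> t] --> c by exact: (@cvgC_cst _ _ (nbhs t)).
have E1 : S (1, 0) = S (0, 0).
  apply: (edge (fun t => (t, 0)) (fun=> S (0, 0))).
  - by move=> t; exact: (cvg_pair (idc t) (cvgR_cst 0)).
  - by move=> t /itv.
  - by move=> t _; exact: cc.
  - by move=> t ut; rewrite clE// S00; have [-> _] := H2 t ut.
  - exact: erefl.
have E2 : S (1, 1) = S (0, 0).
  apply: (edge (fun t => (1, t)) (fun=> S (0, 0))).
  - by move=> t; exact: (cvg_pair (cvgR_cst 1) (idc t)).
  - by move=> t /itv.
  - by move=> t _; exact: cc.
  - by move=> t ut; rewrite clE// S00; have [_ ->] := H1 t ut.
  - exact: E1.
have S01 : S (0, 1) ^+ 2 = S (0, 0) ^+ 2.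
  have [_ ->] := SP (0, 1) (conj i0 i1).
  by rewrite clE// S00; have [-> _] := H1 1 u1; rewrite -g01.
have E3 : S (1, 1) = S (0, 1).
  apply: (edge (fun t => (t, 1)) (fun=> S (0, 1))).
  - by move=> t; exact: (cvg_pair (idc t) (cvgR_cst 1)).
  - by move=> t /itv.
  - by move=> t _; exact: cc.
  - by move=> t ut; rewrite clE// S01 S00; have [_ ->] := H2 t ut.
  - exact: erefl.
have S0n : S (0, 0) != 0.
  by rewrite -sqrf_eq0 S00; apply: h0; have [] := l 0.
have sn : s 0 != 0.
  by rewrite -sqrf_eq0; have [_ A0 _ ->] := l 0; exact: h0.
pose k := S (0, 0) / s 0.
have kn : k != 0 by rewrite mulf_neq0// invr_eq0.
have E4 : S (0, 1) = k * s 1.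
  apply: (edge (fun t => (0, t)) (fun t => k * s t)).
  - by move=> t; exact: (cvg_pair (cvgR_cst 0) (idc t)).
  - by move=> t /itv.
  - by move=> t _; have [_ _ sc _] := l t; exact: (cvgC_mul (cc k t) sc).
  - move=> t ut; rewrite clE//; have [-> _] := H1 t ut.
    have [_ _ _ st] := l t; have [_ _ _ s0] := l 0.
    by rewrite exprMn st /k expr_div_n S00 s0 divff ?mul1r// -s0 expf_neq0.
  - by rewrite /k divfK.
by apply: (mulfI kn); rewrite -E4 -E3 E2 /k divfK.
Qed.

(** The quotient [k] of the final values is a sign. The first lift followed by the reverse of the
    second times [k] is a loop, and [loop_lift] gives [s 0 = k * s 0]. *)
Lemma lift_end_unique (g s g' s' : R -> C) : lift g s -> lift g' s' ->
  g 0 = g' 0 -> s 0 = s' 0 -> g 1 = g' 1 -> s 1 = s' 1.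
Proof.
move=> l l' g00 s00 g11.
have nz (f r : R -> C) t : lift f r -> r t != 0.
  by move=> /(_ t)[_ At _ st]; rewrite -sqrf_eq0 st; exact: h0.
pose k := s 1 / s' 1.
have k2 : k ^+ 2 = 1.
  have [_ _ _ e] := l 1; have [_ _ _ e'] := l' 1.
  by rewrite /k expr_div_n e e' g11 divff// -e' expf_neq0// (nz _ _ _ l').
have lr := reverse_lift l' k2.
have [||G [S [lG G0 G1 S0 S1]]] := concat_lift l lr; rewrite /= ?subr0//.
  by rewrite /k divfK// (nz _ _ _ l').
have := loop_lift lG; rewrite G0 G1 S0 S1 subrr -g00 -s00 => /(_ erefl) e.
have k1 : k = 1.
  by apply: (mulIf (nz _ _ 0 l)); rewrite mul1r -e.
by rewrite -[LHS](divfK (nz _ _ 1 l')) -/k k1 mul1r.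
Qed.

Hypothesis oA : open A.

(** The value at [z] is the final value of the root continued from [x0] along some path, chosen for
    each [z]; [lift_end_unique] makes the choice harmless. *)
Lemma simply_connected_sqrt : exists s : C -> C, forall z, A z ->
  (s w @[w --> z] --> s z) /\ s z ^+ 2 = h z.
Proof.
have [[[x0 Ax0] pcA] _] := scA.
pose c0 := sqrtc (h x0).
have /choice[gs gsP] : forall z, exists gs : (R -> C) * (R -> C), A z ->
    [/\ lift gs.1 gs.2, gs.1 0 = x0, gs.1 1 = z & gs.2 0 = c0].
  move=> z; have [Az|nAz] := pselect (A z); last by exists (fun=> 0, fun=> 0).
  have [g [gc gA g0 g1]] := pcA x0 z Ax0 Az.
  have [|||s [ls s0]] := @path_lift (fun t => g (clamp t)) c0.
  - by move=> t; exact: cvg_clamp.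
  - by move=> t; apply: gA; exists (clamp t) => //; exact: clamp_unit.
  - by rewrite clamp0 g0 sqr_sqrtc.
  exists (fun t => g (clamp (clamp t)), s) => _ /=.
  split; [exact: ls | by rewrite !clamp0 | by rewrite !clamp1 | exact: s0].
exists (fun z => (gs z).2 1) => z Az.
have [lz z0 z1 c1] := gsP z Az.
have sz : (gs z).2 1 ^+ 2 = h z by have [_ _ _] := lz 1; rewrite z1.
split; last exact: sz.
have [e e0 eA] := (openCP _).1 oA z Az.
have hz := h0 Az.
have qc w : A w -> (h u / h z) @[u --> w] --> h w / h z.
  by move=> Aw; exact: (cvgC_mul (hc Aw) (@cvgC_cst _ _ (nbhs w) _ _)).
have [d d0 dP] := (cvgC_atP _ _ _).1 (qc z Az) 1 ltr01.
rewrite divff// in dP.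
have rpos w : normc (w - z) < d -> 0 < Re (h w / h z).
  by move=> /dP; exact: Re_gt0_near1.
pose r := Num.min e d; have r0 : 0 < r by rewrite lt_min e0 d0.
(* Near [z] the path to [w] may be replaced by the path to [z] followed by a segment, along which
   the root is explicit. Continuity at [z] is then that of [psqrt]. *)
have E w : normc (w - z) < r -> (gs z).2 1 * psqrt (h w / h z) = (gs w).2 1.
  rewrite lt_min => /andP[we wd]; have Aw := eA w we.
  have [lw w0 w1 cw] := gsP w Aw.
  pose g2 (t : R) : C := z + (clamp t)%:C * (w - z).
  have g2n t : normc (g2 t - z) <= normc (w - z).
    by apply: normc_segment; exact: clamp_itv.
  have g2c t : g2 u @[u --> t] --> g2 t.
    have tc := clamp_continuous t.
    by move=> U /(cvg_segment z w (clamp t)) /tc.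
  have l2 : lift g2 (fun t => (gs z).2 1 * psqrt (h (g2 t) / h z)).
    move=> t; have At := eA _ (le_lt_trans (g2n t) we).
    have pt := rpos _ (le_lt_trans (g2n t) wd).
    have pc : psqrt (h (g2 u) / h z) @[u --> t] --> psqrt (h (g2 t) / h z).
      by move=> U /(psqrt_continuous pt) /(qc _ At) /g2c.
    split; [exact: g2c|exact: At|exact: (cvgC_mul (cvgC_cst _) pc)|].
    by rewrite exprMn psqrt_sqr// sz mulrC divfK.
  have g20 : g2 0 = z by rewrite /g2 clamp0 mul0r addr0.
  have g21 : g2 1 = w by rewrite /g2 clamp1 mul1r addrC subrK.
  have [||G [S [lG G0 G1 S0 S1]]] := concat_lift lz l2.
  - by rewrite z1 g20.
  - by rewrite g20 divff// psqrt1 mulr1.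
  rewrite -{1}g21 -S1; apply: (lift_end_unique lG lw).
  - by rewrite G0 z0 w0.
  - by rewrite S0 c1 cw.
  - by rewrite G1 g21 w1.
have Ez : (gs z).2 1 * psqrt (h z / h z) = (gs z).2 1.
  by apply: E; rewrite subrr normc0.
rewrite -Ez.
apply: (@cvgC_near _ _ (nbhs z) _ (fun w => (gs z).2 1 * psqrt (h w / h z))).
  by apply/nbhsCP; exists r.
have pz := rpos z; rewrite subrr normc0 in pz.
have pc : psqrt (h w / h z) @[w --> z] --> psqrt (h z / h z).
  by move=> U /(psqrt_continuous (pz d0)) /(qc _ Az).
exact: (cvgC_mul (cvgC_cst _) pc).
Qed.

End Monodromy.

(** * Schwarz lemma and the Caratheodory distance of the complement *)

Section SchwarzPick.
Variable R : realType.
Local Notation C := R[i].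

Lemma bounded_powers_le1 (x B : R) : (forall n, x ^+ n <= B) -> x <= 1.
Proof.
move=> xB; rewrite leNgt; apply/negP => x1.
have bern n : 1 + n%:R * (x - 1) <= x ^+ n.
  elim: n => [|n IH]; first by rewrite mul0r addr0 expr0.
  rewrite exprS -natr1; have n0 : 0 <= n%:R :> R by [].
  have := ler_wpM2l (ltW (lt_trans ltr01 x1)) IH.
  have := mulr_ge0 n0 (sqr_ge0 (x - 1)); rewrite expr2.
  by set N := n%:R; set P := x ^+ n; lra.
have B0 : 0 <= B / (x - 1).
  by rewrite divr_ge0 ?subr_ge0 ?(ltW x1)// (le_trans ler01)// -(expr0 x).
have := archi_boundP B0; rewrite ltr_pdivrMr ?subr_gt0//.
have := bern (Num.bound (B / (x - 1))); have := xB (Num.bound (B / (x - 1))).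
lra.
Qed.

(* Holomorphy of g(z)/z at 0 is avoided: g^(n+1)/z^n extends by 0, and its
   bound gives |g(p)/p|^(n+1) <= 1/|p| for all n. *)
Lemma schwarz (g : C -> C) (p : C) :
  (forall z, unit_disc z -> cder g z) ->
  (forall z, unit_disc z -> normc (g z) <= 1) ->
  g 0 = 0 -> unit_disc p -> normc (g p) <= normc p.
Proof.
move=> dg g1 g0 p1; have [->|p0] := eqVneq p 0; first by rewrite g0 normc0.
have D0 : unit_disc (0 : C) by rewrite /unit_disc /mkset normc0.
have [phi phic gE] := dg 0 D0.
have {}gE z : g z = z * phi z by rewrite gE g0 add0r subr0.
rewrite gE normcM ler_piMr ?normc_ge0//.
set x := normc (phi p); have x0 : 0 <= x := normc_ge0 _.
rewrite leNgt; apply/negP => x1.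
have np : 0 < normc p by rewrite normc_gt0.
(* The midpoint of [x^-1] and 1: a radius below 1 with [x * r > 1], whose powers the maximum
   principle will bound. *)
pose r := (1 + x^-1) / 2.
have xi1 : x^-1 < 1 by rewrite invf_lt1// (lt_trans ltr01).
have r1 : r < 1 by rewrite /r; lra.
have xi0 : 0 < x^-1 by rewrite invr_gt0 (lt_trans ltr01).
have r0 : 0 < r by rewrite /r; lra.
have xn0 : x != 0 by rewrite gt_eqF// (lt_trans ltr01).
have xr : 1 < x * r.
  rewrite (_ : x * r = (x + x / x) / 2); last by rewrite /r; ring.
  by rewrite divff ?xn0//; lra.
suff : x * r <= 1 by rewrite leNgt xr.
apply: (@bounded_powers_le1 _ (normc p * x)^-1) => n.
have px0 : 0 < normc p * x by rewrite mulr_gt0// (lt_trans ltr01).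
rewrite -(ler_pM2l px0) divff ?gt_eqF// exprMn mulrA.
(* At 0 the factor [z] is itself the increment, so continuity of the slope [phi] at 0 is enough;
   elsewhere the function is a quotient of differentiable ones. *)
have dh z : unit_disc z -> cder (fun z => z * phi z ^+ n.+1) z.
  move=> Dz; have [->|z0] := eqVneq z 0.
    exists (fun z => phi z ^+ n.+1); first exact: (cvgC_exp n.+1 phic).
    by move=> w; rewrite mul0r add0r subr0.
  apply: (@cder_near R (fun w => g w ^+ n.+1 / w ^+ n)).
    have [e e0 eP] := (cvgC_atP _ _ _).1 (cvgC_id z) (normc z)
      (eq_ind_r is_true z0 (normc_gt0 z)).
    apply/nbhsCP; exists e => // w /eP wz.
    have w0 : w != 0 by apply: contraTneq wz => ->; rewrite sub0r normcN ltxx.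
    by rewrite gE exprMn exprS; field; rewrite expf_neq0.
  apply: cder_div; first by apply: cder_exp; exact: dg.
    by apply: cder_exp; exact: cder_id.
  by rewrite expf_neq0.
have hM z : r < normc z < 1 -> normc (z * phi z ^+ n.+1) <= (r ^+ n)^-1.
  move=> /andP[rz z1].
  have z0 : 0 < normc z := lt_trans r0 rz.
  rewrite -[leLHS](mulfK (x := normc z ^+ n)) ?expf_neq0 ?gt_eqF//.
  have zn : 0 < normc z ^+ n by rewrite exprn_gt0.
  rewrite -[leRHS]mul1r; apply: ler_pM.
  - by apply: mulr_ge0; [exact: normc_ge0 | exact: ltW].
  - by rewrite invr_ge0 ltW.
  - have -> : normc (z * phi z ^+ n.+1) * normc z ^+ n = normc (g z) ^+ n.+1.
      by rewrite gE !normcM normcX exprMn [normc z ^+ n.+1]exprS; ring.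
    by rewrite exprn_ile1 ?normc_ge0 ?g1.
  - by rewrite lef_pV2 ?posrE ?exprn_gt0// lerXn2r ?nnegrE ?(ltW r0) ?(ltW z0)// ltW.
have := ler_wpM2r (exprn_ge0 n (ltW r0)) (maximum_modulus_annulus r1 dh hM p1).
by rewrite mulVf ?expf_neq0 ?gt_eqF// normcM normcX -/x exprS !mulrA.
Qed.

Lemma tanhE (r : R) : tanh r = (expR (2 * r) - 1) / (expR (2 * r) + 1).
Proof.
have e0 := expR_gt0 r; have en : expR r != 0 by rewrite gt_eqF.
have ep : expR r * expR r + 1 != 0 by rewrite gt_eqF// ltr_wpDl// mulr_ge0 ?ltW.
have -> : expR (2 * r) = expR r * expR r by rewrite mulrDl mul1r expRD.
by rewrite /tanh expRN; field; rewrite ep en.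
Qed.

Lemma tanh_lt1 (r : R) : tanh r < 1.
Proof.
rewrite tanhE ltr_pdivrMr; last by rewrite ltr_wpDl ?expR_ge0.
by rewrite mul1r ltrD2l gtrN.
Qed.

Lemma tanh_gt0 (r : R) : 0 < r -> 0 < tanh r.
Proof.
by move=> r0; rewrite tanhE divr_gt0 ?subr_gt0 -?expR0 ?ltr_expR ?mulr_gt0.
Qed.

Lemma artanh_ratio_gt0 (x : R) : 0 <= x < 1 -> 0 < (1 + x) / (1 - x).
Proof. by move=> /andP[x0 x1]; rewrite divr_gt0 ?subr_gt0// ltr_wpDr. Qed.

Lemma tanh_artanh (x : R) : 0 <= x < 1 -> tanh (artanh x) = x.
Proof.
move=> x01; have q0 := artanh_ratio_gt0 x01; have /andP[x0 x1] := x01.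
rewrite tanhE /artanh [2 * _]mulrC divfK// lnK ?posrE//.
by field; rewrite ?gt_eqF//; lra.
Qed.

Lemma artanh_lt (x r : R) : 0 <= x < 1 -> (artanh x < r) = (x < tanh r).
Proof.
move=> x01; have q0 := artanh_ratio_gt0 x01; have /andP[x0 x1] := x01.
rewrite /artanh ltr_pdivrMr// -[LHS]ltr_expR lnK ?posrE// tanhE [r * 2]mulrC.
rewrite ltr_pdivrMr ?subr_gt0// ltr_pdivlMr; last by rewrite ltr_wpDl ?expR_ge0.
by set F := expR _; apply/idP/idP; lra.
Qed.

Lemma artanh_gt0 (x : R) : 0 < x < 1 -> 0 < artanh x.
Proof.
move=> /andP[x0 x1]; rewrite /artanh divr_gt0// ln_gt0//.
by rewrite ltr_pdivlMr ?subr_gt0//; lra.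
Qed.

Lemma ler_artanh (x y : R) : 0 <= x -> x <= y -> y < 1 -> artanh x <= artanh y.
Proof.
move=> x0 xy y1; have x1 := le_lt_trans xy y1.
rewrite /artanh ler_pM2r ?invr_gt0// ler_ln ?posrE ?artanh_ratio_gt0 ?x0//.
  by rewrite ler_pdivrMr ?subr_gt0// mulrAC ler_pdivlMr ?subr_gt0//; nra.
by rewrite (le_trans x0).
Qed.

Lemma moebiusVK (a z : C) : normc a < 1 -> normc z < 1 ->
  moebius a (moebius (- a) z) = z.
Proof.
by move=> a1 z1; rewrite -{1}(opprK a) moebiusK// normcN.
Qed.

Lemma moebius_oppE (z w : C) : moebius (- z) w = (w - z) / (1 - z^* * w).
Proof. by rewrite /moebius (_ : (- z)^* = - z^*) ?mulNr//; case: z. Qed.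

Lemma moebius_self (z : C) : moebius (- z) z = 0.
Proof. by rewrite /moebius subrr mul0r. Qed.

Section CaratheodoryBall.
Variable K : set C.
Hypotheses (rK : removable K) (KD : K `<=` unit_disc).
Local Notation Omega := (unit_disc `\` K).
Variable z : C.
Hypothesis Oz : Omega z.

Let z1 : normc z < 1 := proj1 Oz.

Let nz1 : normc (- z) < 1.
Proof. by rewrite normcN. Qed.

Lemma normc_moebius01 xi : unit_disc xi -> 0 <= normc (moebius (- z) xi) < 1.
Proof. by move=> x1; rewrite normc_ge0 moebius_lt1. Qed.

(** The extension [g] of [f], composed with [moebius z], fixes 0. The maximum principle yields only
    the weak bound 1 for [g] on [K], and [schwarz] is stated for that bound. *)
Lemma schwarz_pick_removable (f : C -> C) xi : holomorphic_on Omega f ->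
  f @` Omega `<=` unit_disc -> f z = 0 -> Omega xi ->
  normc (f xi) <= normc (moebius (- z) xi).
Proof.
move=> /holomorphicP df fD fz Ox; have [x1 _] := Ox.
have f1 w : Omega w -> normc (f w) <= 1.
  by move=> Ow; apply: ltW; apply: fD; exists w.
have [g dg gE] := removable_extension rK (@open_unit_disc R) KD df f1.
have g1 w : unit_disc w -> normc (g w) <= 1.
  move=> Dw; apply: (@maximum_modulus R K g) => //; first exact: (proj1 rK).
  by move=> u Ou; rewrite gE// f1.
have mD w : unit_disc w -> unit_disc (moebius z w).
  by move=> w1; apply: moebius_lt1.
have m1 : unit_disc (moebius (- z) xi) by apply: moebius_lt1.
have dh w : unit_disc w -> cder (fun w => g (moebius z w)) w.
  move=> Dw; apply: cder_comp; last exact/dg/mD.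
  by apply: cder_moebius => //; apply: ltW.
have h0 : g (moebius z 0) = 0 by rewrite /moebius mulr0 add0r addr0 divr1 gE.
have := schwarz dh (fun w Dw => g1 _ (mD w Dw)) h0 m1.
by rewrite moebiusVK// gE.
Qed.

Lemma caratheodoryE xi : Omega xi ->
  caratheodory Omega z xi = (artanh (normc (moebius (- z) xi)))%:E.
Proof.
move=> Ox; have [x1 _] := Ox; apply/eqP; rewrite eq_le; apply/andP; split.
  apply: ge_ereal_sup => _ [f [df fD fz] <-]; rewrite lee_fin.
  apply: ler_artanh; [exact: normc_ge0 | exact: schwarz_pick_removable |].
  exact: moebius_lt1.
apply: ereal_sup_ubound; exists (moebius (- z)) => //; split.
- apply/holomorphicP => w [w1 _].
  by apply: cder_moebius => //; apply: ltW.
- by move=> _ [w [w1 _] <-]; apply: moebius_lt1.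
- exact: moebius_self.
Qed.

Lemma caratheodory_ballE r : caratheodory_ball Omega z r =
  Omega `&` [set xi | normc (moebius (- z) xi) < tanh r].
Proof.
have H xi : Omega xi ->
    (caratheodory Omega z xi < r%:E)%E = (normc (moebius (- z) xi) < tanh r).
  move=> Ox; rewrite caratheodoryE// lte_fin artanh_lt// normc_moebius01//.
  by case: Ox.
by apply/seteqP; split=> xi [Ox hx]; split=> //; move: hx; rewrite /mkset H.
Qed.

End CaratheodoryBall.

End SchwarzPick.

(** * Pseudo-hyperbolic discs; continuity of inverses of injective holomorphic maps *)

Section PseudoDiscs.
Variable R : realType.
Local Notation C := R[i].

Lemma normc_convex_lt (a b : C) (s t : R) : normc a < t -> normc b < t ->
  0 <= s <= 1 -> normc (a + s%:C * (b - a)) < t.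
Proof.
move=> at_ bt /andP[s0 s1].
have -> : a + s%:C * (b - a) = (1 - s)%:C * a + s%:C * b.
  by rewrite rmorphB rmorph1 /=; ring.
apply: le_lt_trans (ler_normcD _ _) _.
rewrite !normcM !normcR !ger0_norm ?subr_ge0//.
have [->|s_neq0] := eqVneq s 0; first by rewrite subr0 mul1r mul0r addr0.
have sp : 0 < s by rewrite lt_def s_neq0.
have : s * normc b < s * t by rewrite ltr_pM2l.
have : (1 - s) * normc a <= (1 - s) * t by rewrite ler_wpM2l ?subr_ge0// ltW.
by lra.
Qed.

Definition pseudo_disc (z : C) (t : R) : set C :=
  unit_disc `&` [set xi | normc (moebius (- z) xi) < t].

Section SimplyConnected.
Variables (z : C) (t : R).
Hypotheses (z1 : normc z < 1) (t0 : 0 < t) (t1 : t <= 1).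

Let nz1 : normc (- z) < 1. Proof. by rewrite normcN. Qed.

Lemma moebius_pseudo_disc zeta : normc zeta < t ->
  pseudo_disc z t (moebius z zeta).
Proof.
move=> zt; have zeta1 := lt_le_trans zt t1.
by split; [exact: moebius_lt1 | rewrite /mkset moebiusK].
Qed.

Lemma cvg_moebius_within T (F : set_system T) {FF : Filter F} (a : C)
    (g : T -> C) (l : C) : normc a < 1 -> normc l < 1 ->
  g u @[u --> F] --> l -> moebius a (g u) @[u --> F] --> moebius a l.
Proof.
move=> a1 l1 gl; exact: (cvgC_comp gl (cder_continuous (cder_moebius a1 (ltW l1)))).
Qed.

Lemma pseudo_disc_simply_connected : simply_connected (pseudo_disc z t).
Proof.
have I01 (s : R) : unit_interval s -> 0 <= s <= 1.
  by rewrite /unit_interval /= in_itv.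
(* The straight segment in the coordinate [moebius (- z)], where the pseudo-disc is a Euclidean disc
   and hence convex. It serves both as path and as contraction; being constant for [x = y], it fixes
   the base point of a loop. *)
pose seg (x y : C) (s : R) := moebius z
  (moebius (- z) x + s%:C * (moebius (- z) y - moebius (- z) x)).
have segP x y s : pseudo_disc z t x -> pseudo_disc z t y -> unit_interval s ->
    pseudo_disc z t (seg x y s).
  move=> [x1 xt] [y1 yt] /I01 us; apply: moebius_pseudo_disc.
  exact: normc_convex_lt.
have seg0 x y : unit_disc x -> seg x y 0 = x.
  by move=> x1; rewrite /seg mul0r addr0 moebiusVK.
have seg1 x y : unit_disc y -> seg x y 1 = y.
  by move=> y1; rewrite /seg mul1r addrC subrK moebiusVK.
have segxx x s : unit_disc x -> seg x x s = x.
  by move=> x1; rewrite /seg subrr mulr0 addr0 moebiusVK.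
have segc T (F : set_system T) (FF : Filter F) (x y : T -> C) (s : T -> R)
    (x0 y0 : C) (s0 : R) :
    x u @[u --> F] --> x0 -> y u @[u --> F] --> y0 -> s u @[u --> F] --> s0 ->
    pseudo_disc z t x0 -> pseudo_disc z t y0 -> unit_interval s0 ->
    seg (x u) (y u) (s u) @[u --> F] --> seg x0 y0 s0.
  move=> xc yc sc [x1 xt] [y1 yt] /I01 us.
  have xc' : moebius (- z) (x u) @[u --> F] --> moebius (- z) x0.
    exact: (cvg_moebius_within nz1 x1 xc).
  have yc' : moebius (- z) (y u) @[u --> F] --> moebius (- z) y0.
    exact: (cvg_moebius_within nz1 y1 yc).
  have sc' : (s u)%:C @[u --> F] --> s0%:C.
    exact: (@cvg_realC R T F FF s s0%:C sc erefl).
  have lt := lt_le_trans (normc_convex_lt xt yt us) t1.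
  exact: (cvg_moebius_within z1 lt
    (cvgC_add xc' (cvgC_mul sc' (cvgC_sub yc' xc')))).
split.
  split; first by exists z; split; rewrite // /mkset moebius_self normc0.
  move=> x y Px Py; exists (seg x y); split.
  - apply/subspace_continuousP => s us.
    have sc : u @[u --> within (@unit_interval R) (nbhs s)] --> s.
      move=> U V; exact: (@filterS _ (nbhs s) _ _ _ (fun q Hq Iq => Hq) V).
    exact: (segc R (within (@unit_interval R) (nbhs s)) _ (fun=> x) (fun=> y) id
      x y s (cvgC_cst x) (cvgC_cst y) sc Px Py us).
  - by move=> _ [s us <-]; exact: segP.
  - by apply: seg0; case: Px.
  - by apply: seg1; case: Py.
move=> g gc gA g01.
have gP s : unit_interval s -> pseudo_disc z t (g s).
  by move=> us; apply: gA; exists s.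
have u0 : unit_interval (0 : R) by rewrite /unit_interval /= in_itv /= lexx ler01.
have u1 : unit_interval (1 : R) by rewrite /unit_interval /= in_itv /= lexx ler01.
exists (fun p => seg (g p.2) (g 0) p.1); split.
- apply/subspace_continuousP => -[s u] [us uu].
  set W := within _ _.
  have FW : Filter W by exact: within_filter.
  have c1 : g q.2 @[q --> W] --> g u.
    move=> U /((subspace_continuousP _ _).1 gc u uu) gU.
    have {}gU : nbhs u (fun v => unit_interval v -> U (g v)) by exact: gU.
    have f2 : q.2 @[q --> (s, u)] --> u by exact: cvg_snd.
    pose proof (f2 _ gU) as V.
    exact: (@filterS _ (nbhs (s, u)) _ _ _ (fun q Hq Iq => Hq (proj2 Iq)) V).
  have c2 : q.1 @[q --> W] --> s.
    have f1 : q.1 @[q --> (s, u)] --> s by exact: cvg_fst.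
    move=> U /f1 V.
    exact: (@filterS _ (nbhs (s, u)) _ _ _ (fun q Hq Iq => Hq) V).
  exact: (segc _ W FW (fun q => g q.2) (fun=> g 0) fst (g u) (g 0) s
    c1 (cvgC_cst _) c2 (gP u uu) (gP 0 u0) us).
- by move=> _ [[s u] [us uu] <-]; apply: segP => //; exact: gP.
- move=> u uu; split; first by apply: seg0; case: (gP u uu).
  by apply: seg1; case: (gP 0 u0).
- move=> s us; split; first by apply: segxx; case: (gP 0 u0).
  by rewrite /= -g01; apply: segxx; case: (gP 0 u0).
Qed.

End SimplyConnected.

Lemma unit_discE : pseudo_disc 0 1 = unit_disc.
Proof.
apply/seteqP; split=> [x []//|x x1]; split=> //.
rewrite /mkset moebius_oppE (_ : 0^* = 0 :> C) ?mul0r ?subr0 ?divr1//.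
by apply: eqC_ReIm => /=; rewrite ?oppr0.
Qed.

(** The borderline radius 1 of [pseudo_disc_simply_connected], with centre 0. *)
Lemma unit_disc_simply_connected : simply_connected (@unit_disc R).
Proof.
by rewrite -unit_discE; apply: pseudo_disc_simply_connected; rewrite ?normc0.
Qed.

Lemma compact_circle (c : C) (r : R) : 0 <= r ->
  compact [set w | normc (w - c) = r].
Proof.
move=> r0.
(* It maps the unit square onto the closed square of half-side [r] about [c], a compact set
   containing the circle. *)
pose f (p : R * R) : C :=
  c + ((p.1 *+ 2 - 1) * r) +i* ((p.2 *+ 2 - 1) * r).
have cf : compact (f @` unit_square).
  apply: continuous_compact; last exact: compact_unit_square.
  apply: continuous_subspaceT => p.
  have f1 : q.1 @[q --> p] --> p.1 by exact: cvg_fst.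
  have f2 : q.2 @[q --> p] --> p.2 by exact: cvg_snd.
  have g1 : ((q.1 *+ 2 - 1) * r) @[q --> p] --> (p.1 *+ 2 - 1) * r.
    exact: (cvgR_mul (cvgR_add (cvgR_add f1 f1) (cvgR_cst (-1))) (cvgR_cst r)).
  have g2 : ((q.2 *+ 2 - 1) * r) @[q --> p] --> (p.2 *+ 2 - 1) * r.
    exact: (cvgR_mul (cvgR_add (cvgR_add f2 f2) (cvgR_cst (-1))) (cvgR_cst r)).
  exact: (cvgC_add (cvgC_cst c) (cvg_Complex g1 g2)).
apply: (@subclosed_compact _ _ (f @` unit_square)) => //.
  rewrite -[X in closed X]setCK; apply: open_closedC; apply/openCP => w wr.
  exists `|normc (w - c) - r|; first by rewrite normr_gt0 subr_eq0; exact/eqP.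
  move=> u uw ur; move: uw; rewrite -ur; apply/negP; rewrite -leNgt.
  have := lerB_normc (w - c) (u - c); have := lerB_normc (u - c) (w - c).
  rewrite (_ : u - c - _ = u - w); last by ring.
  rewrite (_ : w - c - _ = w - u); last by ring.
  by rewrite (normcB w u) ler_norml => h1 h2; apply/andP; split; lra.
move=> w wr; have Rle := ler_Re_normc (w - c); have Ile := ler_Im_normc (w - c).
rewrite wr in Rle Ile.
have [r00|rn0] := eqVneq r 0.
  exists (0, 0); first by rewrite /unit_square /= lexx ler01.
  have wc : w - c = 0 by apply: eq0_normc; rewrite wr.
  rewrite /f r00 !mulr0 (_ : 0 +i* 0 = 0 :> C)// addr0.
  by apply/esym/eqP; rewrite -subr_eq0 wc.
have rp : 0 < r by rewrite lt_def rn0.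
have bnd x : `|x| <= r -> 0 <= (x / r + 1) / 2 <= 1.
  rewrite ler_norml => /andP[xl xu].
  have : - 1 <= x / r by rewrite ler_pdivlMr// mulN1r.
  have : x / r <= 1 by rewrite ler_pdivrMr// mul1r.
  by move=> h1 h2; apply/andP; split; lra.
exists ((Re (w - c) / r + 1) / 2, (Im (w - c) / r + 1) / 2).
  by split; apply: bnd.
have half (x : R) : x / 2 *+ 2 = x by rewrite -[LHS]mulr_natr divfK.
rewrite /f /= !half !addrK !divfK//.
rewrite (_ : _ +i* _ = w - c); last by case: (w - c).
by rewrite addrC subrK.
Qed.

(** Let [m] be the minimum of the modulus of [f - f zeta0] on a small circle about [zeta0]. If
    [zeta] were outside the circle with [f zeta] within [m / 2] of [f zeta0], injectivity would make
    the reciprocal of [f - f zeta] holomorphic inside; it is at most [2 / m] on the circle and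
    larger at the centre, against [center_le]. *)
Lemma inverse_continuous (f : C -> C) (zeta0 : C) (r : R) :
  (forall z, unit_disc z -> cder f z) ->
  (forall x y, unit_disc x -> unit_disc y -> f x = f y -> x = y) ->
  unit_disc zeta0 -> 0 < r ->
  exists2 d, 0 < d & forall zeta, unit_disc zeta ->
    normc (f zeta - f zeta0) < d -> normc (zeta - zeta0) < r.
Proof.
move=> df inj D0 r0.
have rho0 : 0 < 1 - normc zeta0 by rewrite subr_gt0.
pose r' := Num.min r ((1 - normc zeta0) / 2).
have r'0 : 0 < r' by rewrite lt_min r0 divr_gt0.
have r'r : r' <= r by rewrite ge_min lexx.
have r'rho : r' < 1 - normc zeta0.
  by apply: (@le_lt_trans _ _ ((1 - normc zeta0) / 2));
    [rewrite ge_min lexx orbT | lra].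
have inD w : normc (w - zeta0) < 1 - normc zeta0 -> unit_disc w.
  move=> wz; rewrite /unit_disc /mkset -(subrK zeta0 w).
  by apply: le_lt_trans (ler_normcD _ _) _; rewrite -ltrBrDr.
pose circ := [set w | normc (w - zeta0) = r'].
have c0 : circ !=set0.
  exists (zeta0 + r'%:C).
  by rewrite /circ /mkset addrAC subrr add0r normcR gtr0_norm.
have circD w : circ w -> unit_disc w by move=> cw; apply: inD; rewrite cw.
have fc : {within circ, continuous (fun w => normc (f w - f zeta0))}.
  apply/subspace_continuousP => w cw.
  have wc : normc (f u - f zeta0) @[u --> w] --> normc (f w - f zeta0).
    exact: (cvg_normc (cvgC_sub (cder_continuous (df w (circD w cw)))
      (cvgC_cst (f zeta0)))).
  by move=> U /wc V; exact: (@filterS _ (nbhs w) _ _ _ (fun q Hq _ => Hq) V).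
have [w0 /set_mem cw0 w0P] :=
  compact_EVT_min c0 (@compact_circle zeta0 r' (ltW r'0)) fc.
set m := normc (f w0 - f zeta0) in w0P.
have m0 : 0 < m.
  rewrite normc_gt0 subr_eq0; apply/eqP => /(inj _ _ (circD _ cw0) D0) w0E.
  move: cw0; rewrite /circ /mkset w0E subrr normc0 => r'E.
  by rewrite -r'E ltxx in r'0.
exists (m / 2); first by rewrite divr_gt0.
move=> zeta Dz fz; apply: lt_le_trans r'r; rewrite ltNge; apply/negP => zr.
have zr' : r' < normc (zeta - zeta0).
  rewrite lt_def zr andbT; apply/eqP => zE.
  have := w0P zeta (mem_set zE); move: fz; lra.
(* A radius beyond [r'] within which points are closer to [zeta0] than [zeta] is, so [f] cannot take
   the value [f zeta] there. *)
pose rho := Num.min (normc (zeta - zeta0)) (1 - normc zeta0).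
have fne u : normc (u - zeta0) < rho -> f u - f zeta != 0.
  rewrite lt_min => /andP[uz /inD Du]; rewrite subr_eq0; apply/eqP.
  by move=> /(inj _ _ Du Dz) uE; rewrite uE ltxx in uz.
have := @center_le R (fun u => (f u - f zeta)^-1) zeta0 r' rho (m / 2)^-1 r'0.
rewrite lt_min zr' r'rho => /(_ isT) H.
have : normc (f zeta0 - f zeta)^-1 <= (m / 2)^-1.
  apply: H => w.
    move=> wr; apply: (@cder_inv R (fun u => f u - f zeta) w _ (fne w wr)).
    apply: cder_sub; last exact: cder_cst.
    by apply: df; apply: inD; move: wr; rewrite lt_min => /andP[].
  move=> cw; rewrite normcV lef_pV2 ?posrE ?divr_gt0//; last first.
    by rewrite normc_gt0 fne// cw lt_min zr' r'rho.
  have := w0P w (mem_set cw); have := ler_normcD (f w - f zeta) (f zeta - f zeta0).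
  by rewrite subrKA; lra.
rewrite normcV lef_pV2 ?posrE ?divr_gt0//.
  by rewrite normcB; lra.
rewrite normc_gt0 fne// subrr normc0 lt_min rho0 andbT.
exact: lt_trans zr'.
Qed.

End PseudoDiscs.

(** * Balls that meet a hole and balls that do not *)

Section BallsOfComplement.
Variable R : realType.
Local Notation C := R[i].
Variable K : set C.
Hypotheses (rK : removable K) (KD : K `<=` unit_disc).
Local Notation Omega := (unit_disc `\` K).
Hypothesis domO : domain Omega.
Variable z : C.
Hypothesis Oz : Omega z.

Let rho w := normc (moebius (- z) w).

Let z1 : normc z < 1 := proj1 Oz.
Let nz1 : normc (- z) < 1. Proof. by rewrite normcN. Qed.

Lemma open_rho_lt t : open (unit_disc `&` [set w | rho w < t]).
Proof.
apply/openCP => w [w1 wt].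
have d0 : 0 < t - rho w by rewrite subr_gt0.
have [e e0 eP] := (cvgC_atP _ _ _).1
  (cder_continuous (cder_moebius nz1 (ltW w1))) _ d0.
have [e' e'0 e'P] := (openCP _).1 (@open_unit_disc R) w w1.
exists (Num.min e e'); first by rewrite lt_min e0 e'0.
move=> u; rewrite lt_min => /andP[/eP ue /e'P u1]; split=> //.
have := lerB_normc (moebius (- z) u) (moebius (- z) w).
by rewrite /mkset -/(rho u) -/(rho w); lra.
Qed.

Arguments open_rho_lt t : clear implicits.

(** The common end of both arguments: the ball is an open pseudo-disc minus [K], and the pseudo-disc
    is a neighbourhood of [w] to which [no_local_sqrt] applies. *)
Lemma ball_hole_no_sqrt (r : R) (w : C) (s : C -> C) : K w -> rho w < tanh r ->
  (forall xi, caratheodory_ball Omega z r xi ->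
    (s u @[u --> xi] --> s xi) /\ s xi ^+ 2 = xi - w) -> False.
Proof.
move=> Kw wr; rewrite caratheodory_ballE// => sP.
apply: (@no_local_sqrt R K rK KD domO w
  (unit_disc `&` [set u | rho u < tanh r]) s Kw (open_rho_lt (tanh r))).
  by split; [exact: KD | exact: wr].
by move=> u [[u1 ur] nKu]; apply: sP.
Qed.

Lemma open_ball r : open (caratheodory_ball Omega z r).
Proof.
rewrite caratheodory_ballE// (_ : _ `&` _ =
  Omega `&` (unit_disc `&` [set w | rho w < tanh r])).
  by apply: openI; [case: domO | exact: open_rho_lt].
by apply/seteqP; split=> u [Ou]; [move=> ?; split=> //; split=> //; case: Ou
  | case].
Qed.

Arguments open_ball r : clear implicits.

Lemma ball_not_simply_connected r w : K w -> rho w < tanh r ->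
  ~ simply_connected (caratheodory_ball Omega z r).
Proof.
move=> Kw wr sc.
have hc u : caratheodory_ball Omega z r u -> (v - w) @[v --> u] --> u - w.
  by move=> _; exact: (cvgC_sub (cvgC_id u) (cvgC_cst w)).
have h0 u : caratheodory_ball Omega z r u -> u - w != 0.
  move=> [[_ nKu] _]; rewrite subr_eq0.
  by apply: contra_notN nKu => /eqP ->.
have [s sP] := simply_connected_sqrt hc h0 sc (open_ball r).
exact: ball_hole_no_sqrt Kw wr sP.
Qed.

Lemma ball_not_in_disc_image r w (f : C -> C) : K w -> rho w < tanh r ->
  holomorphic_on unit_disc f -> {in unit_disc &, injective f} ->
  f @` unit_disc `<=` Omega ->
  ~ (caratheodory_ball Omega z r `<=` f @` unit_disc).
Proof.
move=> Kw wr /holomorphicP df inj fO Bf.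
have hc u : unit_disc u -> (f v - w) @[v --> u] --> f u - w.
  by move=> /df /cder_continuous fc; exact: (cvgC_sub fc (cvgC_cst w)).
have h0 u : unit_disc u -> f u - w != 0.
  move=> Du; have [_ nKu] : Omega (f u) by apply: fO; exists u.
  by rewrite subr_eq0; apply: contra_notN nKu => /eqP ->.
have [s sP] := simply_connected_sqrt hc h0 (@unit_disc_simply_connected R)
  (@open_unit_disc R).
have injf x y : unit_disc x -> unit_disc y -> f x = f y -> x = y.
  by move=> Dx Dy; apply: inj; rewrite inE.
(* Chosen preimages form the inverse of [f] on the ball; composed with it, the root of [f - w] on
   the disc becomes a root of [xi - w], continuous by [inverse_continuous]. *)
have /choice[g gP] : forall xi, exists zeta, caratheodory_ball Omega z r xi ->
    unit_disc zeta /\ f zeta = xi.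
  move=> xi; have [Bxi|nB] := pselect (caratheodory_ball Omega z r xi).
    by have [zeta Dz fz] := Bf xi Bxi; exists zeta.
  by exists 0.
apply: (@ball_hole_no_sqrt r w (fun xi => s (g xi)) Kw wr) => xi Bxi.
have [Dg fg] := gP xi Bxi; have [sc s2] := sP _ Dg.
split; last by rewrite s2 fg.
have gc : g u @[u --> xi] --> g xi.
  apply/cvgC_atP => e e0.
  have [d d0 dP] := inverse_continuous df injf Dg e0.
  have [d' d'0 d'P] := (openCP _).1 (open_ball r) xi Bxi.
  exists (Num.min d d'); first by rewrite lt_min d0 d'0.
  move=> u; rewrite lt_min => /andP[ud /d'P Bu]; have [Dgu fgu] := gP u Bu.
  by apply: dP => //; rewrite fgu fg.
exact: (cvgC_comp gc sc).
Qed.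

Section SmallBalls.
Variable r : R.
Hypotheses (r0 : 0 < r) (rm : forall w, K w -> tanh r <= rho w).

Lemma small_ballE : caratheodory_ball Omega z r = pseudo_disc z (tanh r).
Proof.
rewrite caratheodory_ballE//; apply/seteqP; split=> u [].
  by move=> [u1 _] ur.
move=> u1 ur; split=> //; split=> // /rm; rewrite leNgt => /negP; apply.
exact: ur.
Qed.

Lemma small_ball_simply_connected :
  simply_connected (caratheodory_ball Omega z r).
Proof.
rewrite small_ballE; apply: pseudo_disc_simply_connected => //.
  exact: tanh_gt0.
exact/ltW/tanh_lt1.
Qed.

Lemma small_ball_in_disc_image : exists f : C -> C,
  [/\ holomorphic_on unit_disc f, {in unit_disc &, injective f},
      f @` unit_disc `<=` Omega &
      caratheodory_ball Omega z r `<=` f @` unit_disc].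
Proof.
have t0 := tanh_gt0 r0; have t1 := tanh_lt1 r.
pose t := tanh r; have tn : t%:C != 0 :> C.
  by rewrite -normc_gt0 normcR normr_gt0 gt_eqF.
have tz u : unit_disc u -> normc (t%:C * u) < t.
  move=> u1; rewrite normcM normcR gtr0_norm// -[ltRHS]mulr1 ltr_pM2l//.
have tz1 u : unit_disc u -> normc (t%:C * u) < 1.
  by move=> u1; apply: lt_trans t1; exact: tz.
exists (fun u => moebius z (t%:C * u)); split.
- apply/holomorphicP => u u1; apply: cder_comp.
    by apply: cder_mul; [exact: cder_cst | exact: cder_id].
  by apply: cder_moebius => //; apply/ltW/tz1.
- move=> u v; rewrite !inE => u1 v1 /(congr1 (moebius (- z))).
  by rewrite !moebiusK ?tz1// => /(mulfI tn).
- move=> _ [u u1 <-].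
  have : pseudo_disc z t (moebius z (t%:C * u)).
    by apply: moebius_pseudo_disc => //; [exact: ltW | exact: tz].
  by rewrite -small_ballE => -[].
- rewrite small_ballE => xi [x1 xt]; exists (moebius (- z) xi / t%:C).
    by rewrite /unit_disc /mkset normcM normcV normcR gtr0_norm// ltr_pdivrMr// mul1r.
  by rewrite mulrC divfK// moebiusVK.
Qed.

End SmallBalls.

Lemma continuous_rho : {within K, continuous rho}.
Proof.
apply/subspace_continuousP => w Kw.
have wc : rho u @[u --> w] --> rho w.
  exact: (cvg_normc (cder_continuous (cder_moebius nz1 (ltW (KD Kw))))).
by move=> U /wc V; exact: (@filterS _ (nbhs w) _ _ _ (fun q Hq _ => Hq) V).
Qed.

Lemma rho_gt0 w : K w -> 0 < rho w.
Proof.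
move=> Kw; have [_ nKz] := Oz; rewrite normc_gt0 /moebius mulf_neq0//.
  by rewrite subr_eq0; apply: contra_notN nKz => /eqP <-.
by rewrite invr_eq0 moebius_den_neq0// ltW// KD.
Qed.

End BallsOfComplement.

(** Both invariants reduce to this supremum. It is attained at [r = artanh m], which is positive
    because [m > 0] and is sent back to [m] by [tanh] because [m < 1]. *)
Lemma sup_tanh_le (R : realType) (m : R) : 0 < m < 1 ->
  sup [set tanh r | r in [set r : R | 0 < r /\ tanh r <= m]] = m.
Proof.
move=> /andP[m0 m1]; have m01 : 0 <= m < 1 by rewrite ltW.
set E := [set _ | _ in _].
have Em : E m.
  exists (artanh m); last exact: tanh_artanh.
  by split; [rewrite artanh_gt0// m0 | rewrite tanh_artanh].
apply/eqP; rewrite eq_le; apply/andP; split.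
  by apply: ge_sup; [exists m | move=> _ [r [_ rm] <-]].
by apply: ub_le_sup => //; exists m => _ [r [_ rm] <-].
Qed.

Theorem theorem1p1 (R : realType) (K : set R[i]) :
  K !=set0 ->
  removable_in unit_disc K ->
  domain (unit_disc `\` K) ->
  forall z : R[i], (unit_disc `\` K) z ->
    fridman (unit_disc `\` K) z = injectivity_radius (unit_disc `\` K) z /\
    is_minimum [set normc ((w - z) / (1 - z^* * w)) | w in K]
      (injectivity_radius (unit_disc `\` K) z).
Proof.
move=> K0 [rK KD] domO z Oz.
pose rho w := normc (moebius (- z) w).
have [w0 /set_mem Kw0 w0P] :=
  compact_EVT_min K0 (proj1 rK) (continuous_rho KD Oz).
have rho01 : 0 < rho w0 < 1.
  rewrite (rho_gt0 KD Oz Kw0) moebius_lt1//; last exact: KD.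
  by rewrite normcN; case: Oz.
have le_rho r : tanh r <= rho w0 -> forall w, K w -> tanh r <= rho w.
  by move=> rw w Kw; apply: le_trans rw _; apply: w0P; exact: mem_set.
(* The admissible radii are exactly those with [tanh r <= rho w0]. Equality is included because
   balls are defined by a strict inequality and so still miss [w0]. *)
have fridmanE : fridman (unit_disc `\` K) z = rho w0.
  rewrite -[RHS](sup_tanh_le rho01) /fridman; congr (sup (_ @` _)).
  apply/seteqP; split=> r [r0].
    move=> [f [df inj fO Bf]]; split=> //; rewrite leNgt; apply/negP => rw.
    exact: (ball_not_in_disc_image rK KD domO Oz Kw0 rw df inj fO Bf).
  by move=> /le_rho rm; split=> //; exact: small_ball_in_disc_image.
have injE : injectivity_radius (unit_disc `\` K) z = rho w0.
  rewrite -[RHS](sup_tanh_le rho01) /injectivity_radius; congr (sup (_ @` _)).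
  apply/seteqP; split=> r [r0].
    move=> sc; split=> //; rewrite leNgt; apply/negP => rw.
    exact: (ball_not_simply_connected rK KD domO Oz Kw0 rw sc).
  by move=> /le_rho rm; split=> //; exact: small_ball_simply_connected.
rewrite fridmanE injE; split=> //; split.
  by exists w0 => //; rewrite -moebius_oppE.
by move=> _ [w Kw <-]; rewrite -moebius_oppE; apply: w0P; exact: mem_set.
Qed.
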